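(* Let $\mathfrak g=(\mathfrak g_0\oplus\mathfrak g_{-1},d,[\cdot,\cdot],l_3)$ be a Lie $2$-algebra. Let $\mathrm{Aut}^0(\mathfrak g)$ be the Lie group of Lie $2$-algebra automorphisms of $\mathfrak g$ (under composition $\diamond$), and let $\mathrm{Aut}^{-1}(\mathfrak g)$ be the Lie group of units of the monoid $(\mathrm{Hom}(\mathfrak g_0,\mathfrak g_{-1}),\star)$, where $\tau\star\tau'=\tau+\tau'+\tau\circ d\circ\tau'$. Define $$\partial:\mathrm{Aut}^{-1}(\mathfrak g)\to\mathrm{Aut}^0(\mathfrak g),\qquad \partial(\tau)=(I+d\circ\tau,\ I+\tau\circ d,\ l_\tau),$$ $$l_\tau(x,y)=\tau[x,y]-[x,\tau y]-[\tau x,y]-[\tau x,d\tau y]\qquad(x,y\in\mathfrak g_0),$$ and let $\mathrm{Aut}^0(\mathfrak g)$ act on $\mathrm{Aut}^{-1}(\mathfrak g)$ by $$A\triangleright\tau=A_1\circ\tau\circ A_0^{-1},\qquad A=(A_0,A_1,A_2)\in\mathrm{Aut}^0(\mathfrak g),\ \tau\in\mathrm{Aut}^{-1}(\mathfrak g).$$ Then $(\mathrm{Aut}^{-1}(\mathfrak g),\mathrm{Aut}^0(\mathfrak g),\partial,\triangleright)$ is a crossed module of Lie groups.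
   Context: All vector spaces are real and finite-dimensional. A Lie $2$-algebra $\mathfrak g=(\mathfrak g_0\oplus\mathfrak g_{-1},d,[\cdot,\cdot],l_3)$ consists of vector spaces $\mathfrak g_0,\mathfrak g_{-1}$, a linear map $d:\mathfrak g_{-1}\to\mathfrak g_0$, a skew-symmetric bilinear bracket with $[x,y]\in\mathfrak g_0$, $[x,a]=-[a,x]\in\mathfrak g_{-1}$, $[a,b]=0$ for $x,y\in\mathfrak g_0$, $a,b\in\mathfrak g_{-1}$, and a skew-symmetric trilinear map $l_3:\wedge^3\mathfrak g_0\to\mathfrak g_{-1}$ such that for all $x,y,z,x_i\in\mathfrak g_0$, $a,b\in\mathfrak g_{-1}$: (a) $d[x,a]=[x,da]$, $[da,b]=[a,db]$; (b) $[[x,y],z]+[[y,z],x]+[[z,x],y]=-dl_3(x,y,z)$, $[[x,y],a]+[[y,a],x]+[[a,x],y]=-l_3(x,y,da)$; (c) $\sum_{i=1}^4(-1)^{i+1}[x_i,l_3(x_1,\dots,\hat x_i,\dots,x_4)]+\sum_{i<j}(-1)^{i+j}l_3([x_i,x_j],x_1,\dots,\hat x_i,\dots,\hat x_j,\dots,x_4)=0$. A Lie $2$-algebra homomorphism $A=(A_0,A_1,A_2):\mathfrak g\to\mathfrak g'$ consists of linear maps $A_0:\mathfrak g_0\to\mathfrak g_0'$, $A_1:\mathfrak g_{-1}\to\mathfrak g_{-1}'$ with $d'\circ A_1=A_0\circ d$ and a skew-symmetric bilinear map $A_2:\mathfrak g_0\wedge\mathfrak g_0\to\mathfrak g_{-1}'$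 such that (i) $A_0[x,y]-[A_0x,A_0y]'=d'A_2(x,y)$; (ii) $A_1[x,a]-[A_0x,A_1a]'=A_2(x,da)$; (iii) $[A_0x,A_2(y,z)]'+c.p.+l_3'(A_0x,A_0y,A_0z)=A_2([x,y],z)+c.p.+A_1l_3(x,y,z)$, where $c.p.$ denotes the remaining cyclic permutations of $x,y,z$. Composition is $(B\diamond A)_0=B_0A_0$, $(B\diamond A)_1=B_1A_1$, $(B\diamond A)_2=B_2\circ(A_0\times A_0)+B_1\circ A_2$; the identity is $(I_{\mathfrak g_0},I_{\mathfrak g_{-1}},0)$; an automorphism is a homomorphism $\mathfrak g\to\mathfrak g$ invertible for $\diamond$ (equivalently, with $A_0,A_1$ invertible), with inverse $A^{-1}=(A_0^{-1},A_1^{-1},-A_1^{-1}\circ A_2\circ(A_0^{-1}\times A_0^{-1}))$. The smooth structures are those inherited from $\mathrm{End}(\mathfrak g_0)\oplus\mathrm{End}(\mathfrak g_{-1})\oplus\mathrm{Hom}(\wedge^2\mathfrak g_0,\mathfrak g_{-1})$ and from $\mathrm{Hom}(\mathfrak g_0,\mathfrak g_{-1})$, respectively. The identity of $(\mathrm{Hom}(\mathfrak g_0,\mathfrak g_{-1}),\star)$ is $0$. A crossed module of Lie groups is a quadruple $(H_1,H_0,\partial,\triangleright)$ with $H_1,H_0$ Lie groups, $\partial:H_1\to H_0$ a Lie group homomorphism, and $\triangleright$ a (smooth) action of $H_0$ on $H_1$ by automorphisms such that $\partial(g\triangleright h)=g\,\partial(h)\,g^{-1}$ and $\partial(h)\triangleright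 h'=hh'h^{-1}$ for all $g\in H_0$, $h,h'\in H_1$. *)

(* Defs.v *)
From HB Require Import structures.
From mathcomp Require Import all_boot all_order all_algebra.
From mathcomp Require Import boolp classical_sets functions reals.
From mathcomp Require Import topology normedtype derive.

Set Implicit Arguments.
Unset Strict Implicit.
Unset Printing Implicit Defensive.

Import Order.TTheory GRing.Theory Num.Theory.
Import numFieldNormedType.Exports.
Import VectorInternalTheory.

Local Open Scope classical_set_scope.
Local Open Scope ring_scope.

(* For open [U], [Ck_on k U f] says that [f] is of class C^k on [U]. In finite
   dimension, f is C^(k+1) iff it is differentiable and all its directional
   derivatives are C^k. *)
Fixpoint Ck_on (R : realType) (m n k : nat) (U : set 'rV[R]_m)
    (f : 'rV[R]_m -> 'rV[R]_n) : Prop :=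
  match k with
  | 0%N => forall x, U x -> {for x, continuous f}
  | k'.+1 => (forall x, U x -> differentiable f x) /\
             (forall v : 'rV[R]_m, Ck_on k' U (fun x => 'D_v f x))
  end.

(* The topology and the smooth structure of an abstract finite-dimensional
   vector space are read through the coordinates v2r / r2v; they do not depend
   on the choice of the coordinates. *)
Definition vopen (R : realType) (V : vectType R) (O : set V) : Prop :=
  open (r2v @^-1` O).

Definition smooth_on_open (R : realType) (V W : vectType R) (O : set V)
    (F : V -> W) : Prop :=
  forall k, Ck_on k (r2v @^-1` O) (fun x => v2r (F (r2v x))).

(* Smoothness on an arbitrary subset S: local extension to smooth maps on open
   sets of the ambient space. If S is an embedded submanifold, this is
   smoothness for the structure inherited from V. *)
Definition smooth_on (R : realType) (V W : vectType R) (S : set V)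
    (f : V -> W) : Prop :=
  forall x, S x -> exists (O : set V) (F : V -> W),
    [/\ vopen O, O x, smooth_on_open O F &
        forall y, O y -> S y -> F y = f y].

(* M is an embedded submanifold of V: it is locally diffeomorphic to open
   subsets of a fixed finite-dimensional vector space E. *)
Definition smooth_submanifold (R : realType) (V : vectType R) (M : set V) :
    Prop :=
  exists E : vectType R, forall x, M x ->
    exists (U : set E) (O : set V) (phi : E -> V) (psi : V -> E),
      [/\ vopen U, vopen O & O x] /\
      [/\ smooth_on U phi, smooth_on (M `&` O) psi,
          phi @` U = M `&` O & forall u, U u -> psi (phi u) = u].

(* Only the values of [gmul] on [gset] matter. *)
Record groupData (R : realType) := GroupData {
  gamb : vectType R;
  gset : set gamb;
  gmul : gamb -> gamb -> gamb;
  gone : gamb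
}.

Definition ginv (R : realType) (G : groupData R) (x : gamb G) : gamb G :=
  xget 0 [set y | [/\ gset y, gmul x y = gone G & gmul y x = gone G]].

Record is_group (R : realType) (G : groupData R) : Prop := IsGroup {
  group_mul_closed : forall x y : gamb G,
    gset x -> gset y -> gset (gmul x y);
  group_one_closed : gset (gone G);
  group_mulA : forall x y z : gamb G, gset x -> gset y -> gset z ->
    gmul x (gmul y z) = gmul (gmul x y) z;
  group_mul1 : forall x : gamb G, gset x -> gmul (gone G) x = x;
  group_mulr1 : forall x : gamb G, gset x -> gmul x (gone G) = x;
  group_inv : forall x : gamb G, gset x -> exists y : gamb G,
    [/\ gset y, gmul x y = gone G & gmul y x = gone G]
}.

Record is_lie_group (R : realType) (G : groupData R) : Prop := IsLieGroup {
  lie_group : is_group G;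
  lie_submanifold : smooth_submanifold (@gset R G);
  lie_mul_smooth : smooth_on (@gset R G `*` @gset R G)
    (fun p : (gamb G * gamb G)%type => gmul p.1 p.2);
  lie_inv_smooth : smooth_on (@gset R G) (@ginv R G)
}.

Record is_lie_group_hom (R : realType) (G H : groupData R)
    (f : gamb G -> gamb H) : Prop := IsLieGroupHom {
  lie_hom_closed : forall x, gset x -> gset (f x);
  lie_hom_mul : forall x y, gset x -> gset y ->
    f (gmul x y) = gmul (f x) (f y);
  lie_hom_smooth : smooth_on (@gset R G) f
}.

Record is_lie_action (R : realType) (G H : groupData R)
    (act : gamb G -> gamb H -> gamb H) : Prop := IsLieAction {
  act_closed : forall g h, gset g -> gset h -> gset (act g h);
  act_one : forall h, gset h -> act (gone G) h = h;
  act_mul : forall g g' h, gset g -> gset g' -> gset h ->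
    act (gmul g g') h = act g (act g' h);
  (* with the two previous axioms, each g acts by an automorphism of H *)
  act_morph : forall g h h', gset g -> gset h -> gset h' ->
    act g (gmul h h') = gmul (act g h) (act g h');
  act_smooth : smooth_on (@gset R G `*` @gset R H)
    (fun p : (gamb G * gamb H)%type => act p.1 p.2)
}.

Record lie_crossed_module (R : realType) (H1 H0 : groupData R)
    (partial : gamb H1 -> gamb H0) (act : gamb H0 -> gamb H1 -> gamb H1) :
    Prop := LieCrossedModule {
  cm_source : is_lie_group H1;
  cm_target : is_lie_group H0;
  cm_partial : is_lie_group_hom partial;
  cm_act : is_lie_action act;
  cm_equivariant : forall g h, gset g -> gset h ->
    partial (act g h) = gmul (gmul g (partial h)) (ginv g);
  cm_peiffer : forall h h', gset h -> gset h' ->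
    act (partial h) h' = gmul (gmul h h') (ginv h)
}.

Definition linfun2 (R : realType) (U V W : vectType R) (f : U -> V -> W) :
    'Hom(U, 'Hom(V, W)) := linfun (fun x => linfun (f x)).

Lemma linfun_funE (R : realType) (U V : vectType R) (f : U -> V) :
  linear f -> linfun f =1 f.
Proof.
move=> lf x; pose h := GRing.isLinear.Build R U V *:%R f lf.
pose F : {linear U -> V} := HB.pack f h.
exact: (lfunE F x).
Qed.

Lemma linfun2E (R : realType) (U V W : vectType R) (f : U -> V -> W) :
  (forall x, linear (f x)) -> (forall y, linear (f^~ y)) ->
  forall x y, linfun2 f x y = f x y.
Proof.
move=> lr ll x y; rewrite /linfun2 linfun_funE; first exact: linfun_funE.
move=> a u v; apply/lfunP => z.
by rewrite add_lfunE scale_lfunE !(linfun_funE (lr _)) ll.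
Qed.

(* [br x y] is the bracket on g_0, [bra x a] is [x, a] for x in g_0 and a in
   g_{-1}. Trilinear maps are curried. *)
Record lie2algebra (R : realType) := Lie2Algebra {
  g0 : vectType R;
  gm1 : vectType R;
  d : 'Hom(gm1, g0);
  br : 'Hom(g0, 'Hom(g0, g0));
  bra : 'Hom(g0, 'Hom(gm1, gm1));
  l3 : 'Hom(g0, 'Hom(g0, 'Hom(g0, gm1)));
  br_skew : forall x y, br x y = - br y x;
  l3_skew12 : forall x y z, l3 x y z = - l3 y x z;
  l3_skew23 : forall x y z, l3 x y z = - l3 x z y;
  d_bra : forall x a, d (bra x a) = br x (d a);
  (* [da, b] = [a, db], where [a, x] = - [x, a] *)
  bra_d : forall a b, bra (d a) b = - bra (d b) a;
  br_jacobi : forall x y z,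
    br (br x y) z + br (br y z) x + br (br z x) y = - d (l3 x y z);
  (* [[x,y],a] + [[y,a],x] + [[a,x],y] = - l3 (x, y, da) *)
  bra_jacobi : forall x y a,
    bra (br x y) a + (- bra x (bra y a)) + (- bra y (- bra x a))
    = - l3 x y (d a);
  l3_coherence : forall x1 x2 x3 x4,
    (bra x1 (l3 x2 x3 x4) - bra x2 (l3 x1 x3 x4)
     + bra x3 (l3 x1 x2 x4) - bra x4 (l3 x1 x2 x3))
    + (- l3 (br x1 x2) x3 x4 + l3 (br x1 x3) x2 x4 - l3 (br x1 x4) x2 x3
       - l3 (br x2 x3) x1 x4 + l3 (br x2 x4) x1 x3 - l3 (br x3 x4) x1 x2) = 0
}.

(* The bracket [a, x] of a in g_{-1} with x in g_0. *)
Definition brl (R : realType) (g : lie2algebra R) (a : gm1 g) (x : g0 g) :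
  gm1 g := - bra g x a.

(* Triples (A_0, A_1, A_2); A_2 is an arbitrary bilinear map here, its
   skew-symmetry is part of [is_lie2hom]. Hom(/\^2 g_0, g'_{-1}) is a linear
   subspace of 'Hom(g_0, 'Hom(g_0, g'_{-1})), so both ambient spaces induce the
   same smooth structure on sets of homomorphisms. *)
Definition triple (R : realType) (g g' : lie2algebra R) : vectType R :=
  ('Hom(g0 g, g0 g') * 'Hom(gm1 g, gm1 g') *
   'Hom(g0 g, 'Hom(g0 g, gm1 g')))%type.

Section Homomorphisms.
Variable R : realType.

Definition hom0 (g g' : lie2algebra R) (A : triple g g') := A.1.1.
Definition hom1 (g g' : lie2algebra R) (A : triple g g') := A.1.2.
Definition hom2 (g g' : lie2algebra R) (A : triple g g') := A.2.

Record is_lie2hom (g g' : lie2algebra R) (A : triple g g') : Prop :=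
  IsLie2Hom {
  hom2_skew : forall x y, hom2 A x y = - hom2 A y x;
  hom_d : (d g' \o hom1 A)%VF = (hom0 A \o d g)%VF;
  hom_br : forall x y,
    hom0 A (br g x y) - br g' (hom0 A x) (hom0 A y) = d g' (hom2 A x y);
  hom_bra : forall x a,
    hom1 A (bra g x a) - bra g' (hom0 A x) (hom1 A a) = hom2 A x (d g a);
  hom_l3 : forall x y z,
    bra g' (hom0 A x) (hom2 A y z) + bra g' (hom0 A y) (hom2 A z x)
    + bra g' (hom0 A z) (hom2 A x y)
    + l3 g' (hom0 A x) (hom0 A y) (hom0 A z)
    = hom2 A (br g x y) z + hom2 A (br g y z) x + hom2 A (br g z x) y
      + hom1 A (l3 g x y z)
}.

Definition hom_comp (g g' g'' : lie2algebra R) (B : triple g' g'')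
    (A : triple g g') : triple g g'' :=
  ((hom0 B \o hom0 A)%VF, (hom1 B \o hom1 A)%VF,
   linfun2 (fun x y => hom2 B (hom0 A x) (hom0 A y) + hom1 B (hom2 A x y))).

Definition hom_id (g : lie2algebra R) : triple g g := (\1%VF, \1%VF, 0).

Lemma hom_comp2E (g g' g'' : lie2algebra R) (B : triple g' g'')
    (A : triple g g') x y :
  hom2 (hom_comp B A) x y =
  hom2 B (hom0 A x) (hom0 A y) + hom1 B (hom2 A x y).
Proof.
apply: linfun2E => [u a v w|u a v w]; rewrite !linearP /=.
  by rewrite scalerDr addrACA.
by rewrite !add_lfunE !scale_lfunE linearP /= scalerDr addrACA.
Qed.

Definition is_lie2aut (g : lie2algebra R) (A : triple g g) : Prop :=
  is_lie2hom A /\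
  exists B : triple g g,
    [/\ is_lie2hom B, hom_comp B A = hom_id g & hom_comp A B = hom_id g].

Definition Aut0 (g : lie2algebra R) : groupData R :=
  @GroupData R (triple g g) (@is_lie2aut g) (@hom_comp g g g) (hom_id g).

Definition star (g : lie2algebra R) (t t' : 'Hom(g0 g, gm1 g)) :
    'Hom(g0 g, gm1 g) :=
  t + t' + (t \o d g \o t')%VF.

Definition Autm1 (g : lie2algebra R) : groupData R :=
  @GroupData R 'Hom(g0 g, gm1 g)
    [set t | exists s, star t s = 0 /\ star s t = 0] (@star g) 0.

Definition ltau (g : lie2algebra R) (t : 'Hom(g0 g, gm1 g)) :
    'Hom(g0 g, 'Hom(g0 g, gm1 g)) :=
  linfun2 (fun x y => t (br g x y) - bra g x (t y) - brl (t x) y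
                      - brl (t x) (d g (t y))).

Lemma ltauE (g : lie2algebra R) (t : 'Hom(g0 g, gm1 g)) x y :
  ltau t x y = t (br g x y) - bra g x (t y) - brl (t x) y
               - brl (t x) (d g (t y)).
Proof.
have comb (a : R) (p q r s p' q' r' s' : gm1 g) :
  a *: p + p' - (a *: q + q') - (a *: r + r') - (a *: s + s')
  = a *: (p - q - r - s) + (p' - q' - r' - s').
  rewrite !scalerBr !opprD (addrACA (a *: p)) (addrACA (a *: p - a *: q)).
  by rewrite (addrACA (a *: p - a *: q - a *: r)).
rewrite /ltau; apply: linfun2E => [u a v w|u a v w]; rewrite -comb.
  rewrite /brl !linearP /= !add_lfunE !scale_lfunE.
  by rewrite !opprD !scalerN !opprK.
rewrite /brl !linearP /= !add_lfunE !scale_lfunE !linearP /=.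
by rewrite !scalerN ?opprD ?opprK.
Qed.

Definition aut_partial (g : lie2algebra R) (t : gamb (Autm1 g)) :
    gamb (Aut0 g) :=
  (\1%VF + (d g \o t)%VF, \1%VF + (t \o d g)%VF, ltau t).

(* [(f^-1)%VF] is the inverse of [f] when f is bijective, as is the case of
   [hom0 A] for A in Aut0 g. *)
Definition aut_act (g : lie2algebra R) (A : gamb (Aut0 g))
    (t : gamb (Autm1 g)) : gamb (Autm1 g) :=
  (hom1 A \o t \o (hom0 A)^-1)%VF.

End Homomorphisms.

(* Main.v *)
(* The group of invertible triples acts on the vector space of all structures
   (d, [,], l_3), without axioms, by pull-back, and Aut^0(g) is the stabilizer of
   the structure of g. The orbit map A |-> A^* s is equivariant, hence has
   constant rank, so that its fibre Aut^0(g) is a submanifold: a chart at the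
   identity comes from the inverse function theorem (contraction principle), and
   is moved to the other points by right multiplication, which is linear.
   Aut^{-1}(g) is the open set of the tau with 1 + d tau invertible, since
   1 + d (tau * tau') = (1 + d tau)(1 + d tau'), and the star-inverse of tau is
   - tau (1 + d tau)^{-1}. The remaining identities are multilinear algebra. *)
From HB Require Import structures.
Require Import Defs.
From mathcomp Require Import all_boot all_order all_algebra.
From mathcomp Require Import boolp classical_sets functions reals interval_inference.
From mathcomp Require Import topology normedtype sequences landau derive.
From mathcomp Require Import ring lra.

Set Implicit Arguments.
Unset Strict Implicit.
Unset Printing Implicit Defensive.

Import Order.TTheory GRing.Theory Num.Theory.
Import numFieldNormedType.Exports.
Import VectorInternalTheory.

Local Open Scope classical_set_scope.
Local Open Scope ring_scope.

(** * Differentiability and C^k maps on row vectors *)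

(** The homomorphism equations are redundant in general, so the structure of g need not be a regular
    value of the orbit map: constancy of the rank has to stand in for surjectivity of the
    differential. This is why structures carry no axioms. The target of the orbit map is then a
    vector space, and pull-back by a fixed invertible triple is a smooth map on all of it, which is
    what the rank argument asks of the intertwining map. Functoriality must accordingly hold for
    every bilinear A_2, and skew-symmetry of A_2 becomes one more component to be stabilized. The
    rank theorem itself reduces to kernels: along the candidate chart the derivative of F is shown
    to vanish, and the mean value inequality on a ball makes F constant there. *)

Section DiffEps.
Variables (R : realType) (V W : normedModType R).

Lemma diff_eps (f : V -> W) x : differentiable f x ->
  forall e, 0 < e ->
    \forall h \near (0 : V), `|f (h + x) - f x - 'd f x h| <= e * `|h|.
Proof.
move=> /diff_locally/eqaddoP H e /H; apply: filterS => h /=.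
by rewrite opprD addrA.
Qed.

Lemma eps_diff (f : V -> W) x (L : {linear V -> W}) : continuous L ->
  (forall e, 0 < e ->
    \forall h \near (0 : V), `|f (h + x) - f x - L h| <= e * `|h|) ->
  differentiable f x /\ 'd f x = L :> (V -> W).
Proof.
move=> cL H.
have E : f \o shift x = cst (f x) + L +o_ (0 : V) id.
  apply/eqaddoP => e /H; apply: filterS => h /=.
  by rewrite /= !fctE opprD addrA.
have dE := diff_unique cL E; split=> //.
by apply/diff_locallyP; rewrite dE.
Qed.

Lemma near_eq_differentiable (f g : V -> W) x :
  (\forall y \near x, f y = g y) -> differentiable f x -> differentiable g x.
Proof.
move=> fg df; suff [] : differentiable g x /\ 'd g x = 'd f x :> (V -> W) by [].
apply: eps_diff => [|e e0]; first exact: diff_continuous.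
have := diff_eps df e0; apply: filterS2 ((nbhs0P _ _).1 fg).
by move=> h; rewrite addrC => <-; rewrite (nbhs_singleton fg).
Qed.
End DiffEps.

Section ScalarCk.
Variables (R : realType) (m : nat).
Implicit Types (U : set 'rV[R]_m) (f g : 'rV[R]_m -> R).

(** Scalar counterpart of [Ck_on]. Products and inverses are differentiated at this level; vectors
    and matrices are then treated entry by entry through [Ck_onP]. *)
Fixpoint Ck_fun (k : nat) U f : Prop :=
  match k with
  | 0%N => forall x, U x -> {for x, continuous f}
  | k'.+1 => (forall x, U x -> differentiable f x) /\
             (forall v, Ck_fun k' U (fun x => 'D_v f x))
  end.

(** Since U is open, an equality on U holds near each of its points and so passes to derivatives. *)
Lemma Ck_fun_ext k U f g : open U -> {in U, f =1 g} ->
  Ck_fun k U f -> Ck_fun k U g.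
Proof.
move=> oU; elim: k f g => [|k IH] f g fg /=.
  move=> cf x Ux; have nfg : \forall y \near x, f y = g y.
    by apply: filterS (open_nbhs_nbhs (conj oU Ux)) => y Uy; apply/fg/mem_set.
  rewrite /prop_for /continuous_at /= -(fg x (mem_set Ux)).
  exact: cvg_trans (near_eq_cvg nfg) (cf x Ux).
have nfg x : U x -> \forall y \near x, f y = g y.
  move=> Ux; apply: filterS (open_nbhs_nbhs (conj oU Ux)) => y Uy.
  exact/fg/mem_set.
move=> [df Df]; split=> [x Ux|v].
  by apply: near_eq_differentiable (df x Ux); apply: nfg.
by apply: IH (Df v) => x /set_mem Ux; apply: near_eq_derive; apply: nfg.
Qed.

Lemma Ck_funW k U f : Ck_fun k.+1 U f -> Ck_fun k U f.
Proof.
elim: k f => [|k IH] f [df Df].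
  by move=> x Ux; apply/differentiable_continuous/df.
by split=> // v; apply/IH/Df.
Qed.

Lemma Ck_fun_cst k U (c : R) : Ck_fun k U (cst c).
Proof.
elim: k c => [|k IH] c /=; first by move=> x _; apply: cst_continuous.
split=> [x _|v]; first exact: differentiable_cst.
by rewrite (_ : (fun _ => _) = cst 0) //; apply/funext => x; rewrite derive_cst.
Qed.

Lemma Ck_fun_coord k U i : Ck_fun k U (fun x => x 0 i).
Proof.
case: k => [|k]; first by move=> x _; apply: coord_continuous.
split=> [x _|v]; first exact: differentiable_coord.
rewrite (_ : (fun _ => _) = cst (v 0 i)); first exact: Ck_fun_cst.
apply/funext => x /=; have := derive_mx (@derivable_id _ _ x v).
by rewrite derive_id => /(congr1 (fun M : 'M_(_, _) => M 0 i)); rewrite mxE => ->.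
Qed.

Lemma Ck_funD k U f g : open U ->
  Ck_fun k U f -> Ck_fun k U g -> Ck_fun k U (fun x => f x + g x).
Proof.
move=> oU; elim: k f g => [|k IH] f g /=.
  by move=> cf cg x Ux; apply: continuousD; [apply: cf|apply: cg].
move=> [df Df] [dg Dg]; split=> [x Ux|v].
  by apply: differentiableD; [apply: df|apply: dg].
apply: (Ck_fun_ext oU _ (IH _ _ (Df v) (Dg v))) => x /set_mem Ux.
by rewrite [RHS]deriveD //; apply: diff_derivable; [apply: df|apply: dg].
Qed.

Lemma Ck_funM k U f g : open U ->
  Ck_fun k U f -> Ck_fun k U g -> Ck_fun k U (fun x => f x * g x).
Proof.
move=> oU; elim: k f g => [|k IH] f g.
  by move=> cf cg x Ux; apply: continuousM; [apply: cf|apply: cg].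
move=> Cf Cg; have [[df Df] [dg Dg]] := (Cf, Cg); split=> [x Ux|v].
  by apply: differentiableM; [apply: df|apply: dg].
apply: (@Ck_fun_ext _ _ (fun x => f x * 'D_v g x + g x * 'D_v f x)) => //.
  move=> x /set_mem Ux.
  by rewrite [RHS]deriveM //; apply: diff_derivable; [apply: df|apply: dg].
by apply: Ck_funD => //; apply: IH; solve [exact: Df | exact: Dg | exact: Ck_funW].
Qed.

Lemma Ck_fun_sum k U (I : Type) (r : seq I) (F : I -> 'rV[R]_m -> R) : open U ->
  (forall i, Ck_fun k U (F i)) -> Ck_fun k U (fun x => \sum_(i <- r) F i x).
Proof.
move=> oU CF; elim: r => [|i r IH].
  rewrite (_ : (fun _ => _) = cst 0); first exact: Ck_fun_cst.
  by apply/funext => x; rewrite big_nil.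
rewrite (_ : (fun _ => _) = fun x => F i x + \sum_(j <- r) F j x).
  exact: Ck_funD.
by apply/funext => x; rewrite big_cons.
Qed.

Lemma Ck_fun_prod k U (I : Type) (r : seq I) (F : I -> 'rV[R]_m -> R) : open U ->
  (forall i, Ck_fun k U (F i)) -> Ck_fun k U (fun x => \prod_(i <- r) F i x).
Proof.
move=> oU CF; elim: r => [|i r IH].
  rewrite (_ : (fun _ => _) = cst 1); first exact: Ck_fun_cst.
  by apply/funext => x; rewrite big_nil.
rewrite (_ : (fun _ => _) = fun x => F i x * \prod_(j <- r) F j x).
  exact: Ck_funM.
by apply/funext => x; rewrite big_cons.
Qed.

(** The derivative of 1/f is a product in which 1/f is needed only at the previous order, so the
    induction closes through [Ck_funM]. *)
Lemma Ck_funV k U f : open U -> (forall x, U x -> f x != 0) ->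
  Ck_fun k U f -> Ck_fun k U (fun x => (f x)^-1).
Proof.
move=> oU f0; elim: k f f0 => [|k IH] f f0.
  by move=> cf x Ux; apply: continuousV; [apply: f0|apply: cf].
move=> Cf; have [df Df] := Cf; split=> [x Ux|v].
  by apply: differentiableV; [apply: df|apply: f0].
apply: (@Ck_fun_ext _ _ (fun x => -1 * ((f x)^-1 * (f x)^-1) * 'D_v f x)) => //.
  move=> x /set_mem Ux.
  rewrite [RHS]deriveV ?f0 //; last by apply: diff_derivable; apply: df.
  by rewrite -exprVn mulN1r /GRing.scale /= exprVn expr2 invfM.
have CV : Ck_fun k U (fun x => (f x)^-1) by apply: IH => //; apply: Ck_funW.
apply: Ck_funM (Df v) => //; apply: (Ck_funM oU (Ck_fun_cst k U (-1))).
exact: Ck_funM.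
Qed.
End ScalarCk.

Section VectorCk.
Variable R : realType.

Lemma differentiable_rV (V : normedModType R) n (f : V -> 'rV[R]_n) x :
  differentiable f x <-> forall i, differentiable (fun y => f y 0 i) x.
Proof.
split=> [df i|df].
  exact: (differentiable_comp df (differentiable_coord _ 0 i)).
have -> : f = \sum_i (fun y => f y 0 i *: delta_mx 0 i).
  by apply/funext => y; rewrite fct_sumE -row_sum_delta.
apply: differentiable_sum => i; exact: differentiableZl.
Qed.

Lemma derive_coord (V : normedModType R) n (f : V -> 'rV[R]_n) x v i :
  differentiable f x -> 'D_v f x 0 i = 'D_v (fun y => f y 0 i) x.
Proof. by move=> df; rewrite derive_mx ?mxE //; apply: diff_derivable. Qed.

Lemma derive_delta n (W : normedModType R) (f : 'rV[R]_n -> W) x v :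
  differentiable f x -> 'D_v f x = \sum_j v 0 j *: 'D_(delta_mx 0 j) f x.
Proof.
move=> df; rewrite deriveE // {1}[v]row_sum_delta linear_sum /=.
by apply: eq_bigr => j _; rewrite linearZ deriveE.
Qed.

Lemma derive_comp (U V W : normedModType R) (f : U -> V) (g : V -> W) x v :
  differentiable f x -> differentiable g (f x) ->
  'D_v (g \o f) x = 'D_('D_v f x) g (f x).
Proof.
move=> df dg; rewrite deriveE; last exact: differentiable_comp.
by rewrite diff_comp //= [in RHS]deriveE // deriveE.
Qed.

Lemma Ck_onP m n k (U : set 'rV[R]_m) (f : 'rV[R]_m -> 'rV[R]_n) : open U ->
  Ck_on k U f <-> forall i, Ck_fun k U (fun x => f x 0 i).
Proof.
move=> oU; elim: k f => [|k IH] f /=.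
  split=> [cf i x Ux|cf x Ux].
    apply: (@continuous_comp _ _ _ f (fun M : 'rV__ => M 0 i)); first exact: cf.
    exact: coord_continuous.
  suff H e : 0 < e -> \forall y \near x, `|f x - f y| <= e.
    exact: (cvgrPdist_le _ _).2 H.
  move=> e0; have : \forall y \near x, forall i, `|f x 0 i - f y 0 i| <= e.
    apply: (@filter_forall _ _ _ (nbhs x)) => i.
    exact: ((cvgrPdist_le _ _).1 (cf i x Ux) e e0).
  apply: filterS => y H; rewrite [leLHS]/Num.Def.normr /= mx_normrE.
  by rewrite (bigmax_le _ (ltW e0)) // => -[j i] _ /=; rewrite !mxE ord1; apply: H.
split=> [[df Df] i|H].
  split=> [x Ux|v]; first exact: ((differentiable_rV f x).1 (df x Ux) i).
  apply: Ck_fun_ext ((IH _).1 (Df v) i) => // x /set_mem Ux.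
  by apply: derive_coord; apply: df.
have df x : U x -> differentiable f x.
  by move=> Ux; apply/differentiable_rV => i; have [Hi _] := H i; apply: Hi.
split=> // v; apply/IH => i; apply: Ck_fun_ext ((H i).2 v) => // x /set_mem Ux.
by rewrite derive_coord //; apply: df.
Qed.

Lemma Ck_onW m n k (U : set 'rV[R]_m) (f : 'rV[R]_m -> 'rV[R]_n) :
  Ck_on k.+1 U f -> Ck_on k U f.
Proof.
elim: k f => [|k IH] f [df Df].
  by move=> x Ux; apply/differentiable_continuous/df.
by split=> // v; apply/IH/Df.
Qed.

(** The chain rule differentiates g in a direction that varies with x. Expanding this direction in
    the standard basis leaves derivatives in fixed directions, to which the induction hypothesis
    applies. *)
Lemma Ck_fun_comp m n k (U : set 'rV[R]_m) (W : set 'rV[R]_n)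
    (f : 'rV[R]_m -> 'rV[R]_n) (g : 'rV[R]_n -> R) :
  open U -> open W -> (forall x, U x -> W (f x)) ->
  Ck_on k U f -> Ck_fun k W g -> Ck_fun k U (fun x => g (f x)).
Proof.
move=> oU oW UW; elim: k f g UW => [|k IH] f g UW.
  move=> cf cg x Ux; apply: (@continuous_comp _ _ _ f g); first exact: cf.
  exact/cg/UW.
move=> Cf Cg; have [[df Df] [dg Dg]] := (Cf, Cg).
split=> [x Ux|v]; first by apply: differentiable_comp; [apply: df|apply/dg/UW].
apply: (@Ck_fun_ext _ _ _ _
  (fun x => \sum_j 'D_v f x 0 j * 'D_(delta_mx 0 j) g (f x))) => //.
  move=> x /set_mem Ux; rewrite [RHS]derive_comp; [|exact: df|exact/dg/UW].
  by rewrite [RHS]derive_delta //; apply/dg/UW.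
apply: Ck_fun_sum => // j; apply: Ck_funM => //.
  exact: ((Ck_onP _ _ oU).1 (Df v) j).
by apply: (IH f _ UW) (Dg _); apply: Ck_onW.
Qed.

Lemma Ck_on_comp m n p k (U : set 'rV[R]_m) (W : set 'rV[R]_n)
    (f : 'rV[R]_m -> 'rV[R]_n) (g : 'rV[R]_n -> 'rV[R]_p) :
  open U -> open W -> (forall x, U x -> W (f x)) ->
  Ck_on k U f -> Ck_on k W g -> Ck_on k U (fun x => g (f x)).
Proof.
move=> oU oW UW Cf /(Ck_onP _ _ oW) Cg; apply/Ck_onP => // i.
exact: Ck_fun_comp Cf (Cg i).
Qed.

Lemma Ck_on_ext m n k (U : set 'rV[R]_m) (f g : 'rV[R]_m -> 'rV[R]_n) :
  open U -> {in U, f =1 g} -> Ck_on k U f -> Ck_on k U g.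
Proof.
move=> oU fg /(Ck_onP _ _ oU) Cf; apply/Ck_onP => // i.
by apply: Ck_fun_ext (Cf i) => // x /fg ->.
Qed.

Lemma Ck_on_linear m n k (U : set 'rV[R]_m) (f : {linear 'rV[R]_m -> 'rV[R]_n}) :
  open U -> Ck_on k U f.
Proof.
move=> oU; apply/Ck_onP => // i.
have -> : (fun x => f x 0 i) = fun x => \sum_j x 0 j * f (delta_mx 0 j) 0 i.
  apply/funext => x; rewrite {1}[x]row_sum_delta linear_sum summxE.
  by apply: eq_bigr => j _; rewrite linearZ mxE.
apply: Ck_fun_sum => // j; apply: Ck_funM => //; first exact: Ck_fun_coord.
exact: (@Ck_fun_cst _ _ _ U (f (delta_mx 0 j) 0 i)).
Qed.

Lemma linear_rV_continuous m n (f : {linear 'rV[R]_m -> 'rV[R]_n}) : continuous f.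
Proof. by move=> x; apply: (@Ck_on_linear m n 0 setT f openT x I). Qed.

End VectorCk.

(** * Regularity of determinants and inverse matrices *)

Section MatrixCk.
Variables (R : realType) (m : nat).

Lemma Ck_fun_det k (U : set 'rV[R]_m) n (M : 'rV[R]_m -> 'M[R]_n) : open U ->
  (forall i j, Ck_fun k U (fun x => M x i j)) -> Ck_fun k U (fun x => \det (M x)).
Proof.
move=> oU CM; apply: Ck_fun_sum => // s; apply: Ck_funM => //.
  exact: Ck_fun_cst.
exact: Ck_fun_prod.
Qed.

(** Cramer's formula: each entry is a cofactor divided by the determinant. *)
Lemma Ck_fun_invmx k (U : set 'rV[R]_m) n (M : 'rV[R]_m -> 'M[R]_n) : open U ->
  (forall x, U x -> M x \in unitmx) ->
  (forall i j, Ck_fun k U (fun x => M x i j)) ->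
  forall i j, Ck_fun k U (fun x => invmx (M x) i j).
Proof.
move=> oU Mu CM i j.
apply: (@Ck_fun_ext _ _ _ _ (fun x => (\det (M x))^-1 * cofactor (M x) j i)) => //.
  by move=> x /set_mem Ux; rewrite /invmx Mu // !mxE.
apply: Ck_funM => //.
  apply: Ck_funV => // [x /Mu|]; last exact: Ck_fun_det.
  by rewrite unitmxE unitfE.
apply: Ck_funM => //; first exact: Ck_fun_cst.
apply: Ck_fun_det => // a b.
rewrite (_ : (fun x => _) = fun x => M x (lift j a) (lift i b)) //.
by apply/funext => x; rewrite !mxE.
Qed.
End MatrixCk.

(** * The inverse function theorem *)

Section MeanValue.
Variable R : realType.

Lemma ball_segment (V : normedModType R) (e x y : V) (r t : R) :
  ball e r x -> ball e r y -> 0 <= t <= 1 -> ball e r (y + t *: (x - y)).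
Proof.
rewrite -ball_normE /= => xr yr /andP[t0 t1].
have -> : e - (y + t *: (x - y)) = (1 - t) *: (e - y) + t *: (e - x).
  have -> : x - y = (e - y) - (e - x) by rewrite opprB [RHS]addrC addrA subrK.
  by rewrite opprD addrA scalerBl scale1r [in LHS]scalerBr opprB addrA addrAC.
apply: le_lt_trans (ler_normD _ _) _; rewrite !normrZ (ger0_norm t0).
rewrite ger0_norm ?subr_ge0 //.
(* At t = 1 the weight of y vanishes and strictness comes from x; otherwise it comes from y. *)
have [->|tn] := eqVneq t 1; first by rewrite subrr mul0r add0r mul1r.
have t1' : 0 < 1 - t by rewrite subr_gt0 lt_neqAle tn.
have H1 : (1 - t) * `|e - y| < (1 - t) * r by rewrite ltr_pM2l.
have H2 : t * `|e - x| <= t * r by rewrite ler_wpM2l // ltW.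
by apply: lt_le_trans (ltr_leD H1 H2) _; rewrite -mulrDl subrK mul1r.
Qed.

Lemma is_derive_segment (V : normedModType R) (f : V -> R) (y v : V) t :
  differentiable f (y + t *: v) ->
  is_derive t 1 (fun s : R => f (y + s *: v)) ('D_v f (y + t *: v)).
Proof.
move=> df; pose l := fun s : R => y + s *: v.
have ds : differentiable (fun s : R => s *: v) t by exact: ex_diff.
have Dl : differentiable l t.
  by apply: (@differentiableD _ _ _ (cst y) (fun s : R => s *: v)).
have dl : 'D_1 l t = v.
  rewrite (@deriveD _ _ _ (cst y) (fun s : R => s *: v)); first last.
  - exact: diff_derivable.
  - exact: derivable_cst.
  by rewrite derive_cst add0r deriveE // diff_val scale1r.
have dfl : differentiable (f \o l) t by apply: differentiable_comp.
split; first exact: diff_derivable.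
by rewrite (@derive_comp _ _ _ _ l f) // dl.
Qed.

Lemma mean_value (V : normedModType R) (f : V -> R) (c : R) x y :
  (forall t, 0 <= t <= 1 -> differentiable f (y + t *: (x - y))) ->
  (forall t, 0 <= t <= 1 -> `|'D_(x - y) f (y + t *: (x - y))| <= c) ->
  `|f x - f y| <= c.
Proof.
move=> df Df; pose v := x - y; pose phi (s : R) := f (y + s *: v).
have dphi (s : R) : 0 <= s <= 1 -> is_derive s 1 phi ('D_v f (y + s *: v)).
  by move=> s01; apply/is_derive_segment/df.
have [||s s01] := @MVT R phi (fun s => 'D_v f (y + s *: v)) 0 1 ltr01.
- by move=> s; rewrite in_itv /= => /andP[s0 s1]; apply: dphi; rewrite !ltW.
- apply: derivable_within_continuous => s; rewrite in_itv /= => /dphi.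
  by case.
rewrite /phi scale1r scale0r addr0 /v (addrC y) subrK subr0 mulr1 => ->.
by apply: Df; move: s01; rewrite in_itv /= => /andP[s0 s1]; rewrite !ltW.
Qed.

Lemma coord_norm n (x : 'rV[R]_n) i : `|x 0 i| <= `|x|.
Proof.
rewrite [leRHS]/Num.Def.normr /= mx_normrE.
exact: (le_bigmax _ (fun ij : 'I_1 * 'I_n => `|x ij.1 ij.2|) (0, i)).
Qed.

Lemma rV_norm_le n (x : 'rV[R]_n) (c : R) : 0 <= c ->
  (forall i, `|x 0 i| <= c) -> `|x| <= c.
Proof.
move=> c0 xc; rewrite [leLHS]/Num.Def.normr /= mx_normrE.
by rewrite (bigmax_le _ c0) // => -[j i] _ /=; rewrite ord1.
Qed.

(** The intermediate points differ from one coordinate to the next, but as the norm is the maximum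
    of the coordinates the bound survives without loss. *)
Lemma mean_value_rV n (V : normedModType R) (f : V -> 'rV[R]_n) (c : R) x y :
  0 <= c ->
  (forall t, 0 <= t <= 1 -> differentiable f (y + t *: (x - y))) ->
  (forall t, 0 <= t <= 1 -> `|'D_(x - y) f (y + t *: (x - y))| <= c) ->
  `|f x - f y| <= c.
Proof.
move=> c0 df Df; apply: rV_norm_le => // i.
rewrite !mxE; apply: (@mean_value V (fun z => f z 0 i)) => t t01.
  exact: ((differentiable_rV f _).1 (df t t01) i).
rewrite -derive_coord; last exact: df.
exact: le_trans (coord_norm _ _) (Df _ t01).
Qed.

End MeanValue.

(** Makes row vectors a complete normed space, as the contraction principle requires. *)
HB.instance Definition _ (R : realType) (m n : nat) := Complete.on 'M[R]_(m, n).

Section InverseFunction.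
Variables (R : realType) (n : nat).
Implicit Types (f : 'rV[R]_n -> 'rV[R]_n) (e x y v : 'rV[R]_n).

(** Continuity of the n partial derivatives at e controls all directions at once, by expansion in
    the basis. *)
Lemma near_diff_bound (G : set 'rV[R]_n) f e : open G -> G e ->
  Ck_on 1 G f -> (forall v, 'D_v f e = v) ->
  \forall z \near e, G z /\ forall v, `|'D_v f z - v| <= 2^-1 * `|v|.
Proof.
move=> oG Ge [df Df] dfe.
(* The n partial errors add up to at most n / (2 (n + 1)) <= 1/2; the successor keeps the constant
   meaningful for n = 0. *)
pose eps : R := (2 * n.+1%:R)^-1.
have eps0 : 0 < eps by rewrite invr_gt0 mulr_gt0.
have : \forall z \near e, forall j : 'I_n,
    `|'D_(delta_mx 0 j) f e - 'D_(delta_mx 0 j) f z| <= eps.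
  apply: (@filter_forall _ _ _ (nbhs e)) => j.
  exact: ((cvgrPdist_le _ _).1 (Df _ e Ge) eps eps0).
apply: filterS2 (open_nbhs_nbhs (conj oG Ge)) => z Gz H; split=> // v.
rewrite derive_delta; last exact: df.
rewrite {2}[v]row_sum_delta -sumrB.
apply: le_trans (ler_norm_sum _ _ _) _.
apply: (@le_trans _ _ (\sum_(j < n) eps * `|v|)).
  apply: ler_sum => j _; rewrite -scalerBr normrZ mulrC.
  by rewrite ler_pM // ?coord_norm // distrC -{1}(dfe (delta_mx 0 j)) H.
rewrite sumr_const card_ord -mulrnAl ler_wpM2r // /eps invfM -mulr_natr -mulrA.
by rewrite ler_piMr ?invr_ge0 // mulrC ler_pdivrMr // mul1r ler_nat.
Qed.

Variables (f : 'rV[R]_n -> 'rV[R]_n) (e : 'rV[R]_n) (r : R).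
Hypothesis r0 : 0 < r.
Hypothesis df : forall z, ball e r z -> differentiable f z.
Hypothesis Df : forall z v, ball e r z -> `|'D_v f z - v| <= 2^-1 * `|v|.

(** Mean value inequality for f - id, whose derivative has norm at most 1/2 on the convex ball. *)
Lemma near_id_lipschitz x y : ball e r x -> ball e r y ->
  `|(f x - f y) - (x - y)| <= 2^-1 * `|x - y|.
Proof.
move=> xr yr.
have -> : (f x - f y) - (x - y) = (f x - x) - (f y - y).
  by apply/rowP => i; rewrite !mxE; ring.
apply: (@mean_value_rV _ _ _ (fun z => f z - z)) => [|t t01|t t01].
- by rewrite mulr_ge0.
- by apply: differentiableB => //; apply/df/ball_segment.
have zr := ball_segment xr yr t01.
rewrite deriveB //; last exact/diff_derivable/df.
by rewrite derive_id; apply: Df.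
Qed.

Lemma near_id_expansive x y : ball e r x -> ball e r y ->
  `|x - y| <= 2 * `|f x - f y|.
Proof.
move=> xr yr; have := near_id_lipschitz xr yr.
have := ler_normD (f x - f y) ((x - y) - (f x - f y)).
rewrite addrC subrK [`|x - y - _|]distrC.
move: `|x - y| `|f x - f y| `|_ - _| => a b c; lra.
Qed.

(** The solutions of f x = y are the fixed points of [T x = x + (y - f x)], a contraction of ratio
    1/2. *)
Lemma near_id_surj y : ball (f e) (r / 4) y -> exists2 x, ball e r x & f x = y.
Proof.
move=> yb; have yr : `|f e - y| < r / 4 by move: yb; rewrite -ball_normE.
(* A closed set inside the open ball of radius r, and stable under [T]: the distance from e to T x
   is at most r/4 + (1/2)(r/2) = r/2. *)
pose U : set 'rV[R]_n := [set x | `|e - x| <= r / 2].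
have Ur x : U x -> ball e r x.
  rewrite /U -ball_normE /= => /le_lt_trans; apply; move: r0; lra.
have ber : ball e r e by apply: ballxx.
pose T (x : 'rV[R]_n) : 'rV[R]_n := x + (y - f x).
have UT : {homo T : x / U x >-> U x}.
  move=> x Ux; rewrite /U /=.
  have := near_id_lipschitz ber (Ur _ Ux); have := Ux; rewrite /U /=.
  have -> : e - T x = (f e - y) - ((f e - f x) - (e - x)).
    by apply/rowP => i; rewrite !mxE; ring.
  have := ler_normB (f e - y) ((f e - f x) - (e - x)).
  move: yr; move: `|e - x| `|f e - y| `|_ - _ - _| `|_ - (_ - _)| => a b c d.
  lra.
have cT : is_contraction (mkfun_fun UT).
  exists (2^-1)%:nng; split=> [|[x z] [/= Ux Uz]]; first by rewrite /=; lra.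
  have := near_id_lipschitz (Ur _ Ux) (Ur _ Uz); rewrite distrC.
  by congr (`|_| <= _); apply/rowP => i; rewrite !mxE; ring.
have clU : closed U by exact: closed_closed_ball_.
have [|x Ux Tx] := banach_fixed_point cT clU.
  by exists e; rewrite /U /= subrr normr0 divr_ge0 // ltW.
exists x; first exact: Ur.
have /(congr1 (fun z => y - (z - x))) : T x = x by exact: esym Tx.
rewrite subrr subr0 => <-; apply/rowP => i; rewrite !mxE; ring.
Qed.

End InverseFunction.

(** Transpose of the usual Jacobian matrix, because vectors are rows and are multiplied on the
    left. *)
Definition jac (R : realType) n m (f : 'rV[R]_n -> 'rV[R]_m) x : 'M[R]_(n, m) :=
  \matrix_(i, j) 'D_(delta_mx 0 i) f x 0 j.

Lemma jacE (R : realType) n m (f : 'rV[R]_n -> 'rV[R]_m) x v :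
  differentiable f x -> v *m jac f x = 'D_v f x.
Proof.
move=> df; rewrite derive_delta //; apply/rowP => j.
by rewrite !mxE summxE; apply: eq_bigr => i _; rewrite !mxE.
Qed.

Section InverseFunctionTheorem.
Variables (R : realType) (n : nat).

(** For u = g(y + h) - g(y), the vector h - u J is the first-order remainder of f at g(y), hence
    o(|u|). The Lipschitz bound turns this into o(|h|), and applying J^-1 gives the expansion of
    g. *)
Lemma inverse_differentiable (f g : 'rV[R]_n -> 'rV[R]_n) y (C : R) :
  differentiable f (g y) -> jac f (g y) \in unitmx ->
  (\forall z \near y, f (g z) = z /\ `|g z - g y| <= C * `|z - y|) ->
  differentiable g y /\ forall v, 'D_v g y = v *m invmx (jac f (g y)).
Proof.
move=> df uJ fg; set J := jac _ _ in uJ *.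
pose L : {linear 'rV[R]_n -> 'rV[R]_n} := mulmxr (invmx J).
have cL : continuous L by exact: linear_rV_continuous.
have [k k0 Lk] := linear_lipschitz cL.
have fgy := (nbhs_singleton fg).1.
(* A strictly positive bound, since [C] is arbitrary and a division by it follows. *)
pose C' := `|C| + 1; have C'0 : 0 < C' by rewrite ltr_wpDl.
have fg' : \forall h \near (0 : 'rV[R]_n),
    f (g (h + y)) = h + y /\ `|g (h + y) - g y| <= C' * `|h|.
  have := (nbhs0P _ _).1 fg; apply: filterS => h; rewrite addrC => -[-> H].
  split=> //; apply: le_trans H _; rewrite addrK ler_wpM2r //.
  by rewrite /C' (le_trans (ler_norm C)) // lerDl.
suff [dg dgE] : differentiable g y /\ 'd g y = L :> ('rV_n -> 'rV_n).
  by split=> // v; rewrite deriveE // dgE.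
apply: eps_diff => // eps eps0.
(* Chosen so that the norm bound [k] of [L], the remainder bound and the Lipschitz constant [C']
   multiply to [eps]. *)
pose eps' := eps / (k * C').
have eps'0 : 0 < eps' by rewrite divr_gt0 // mulr_gt0.
have /nbhs_ballP[d /= d0 Hd] := diff_eps df eps'0.
have : \forall h \near (0 : 'rV[R]_n), `|h| < d / C'.
  have := @nbhsx_ballx _ _ (0 : 'rV[R]_n) (d / C') (divr_gt0 d0 C'0).
  by apply: filterS => h; rewrite -ball_normE /= sub0r normrN.
apply: filterS2 fg' => h [fgh gh] hd.
pose u := g (h + y) - g y.
have ud : `|u| < d.
  by apply: le_lt_trans gh _; rewrite mulrC -ltr_pdivlMr.
have := Hd u; rewrite -ball_normE /= sub0r normrN => /(_ ud).
rewrite /u subrK fgh fgy addrK -deriveE // -jacE // -/J -/u => Hu.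
have -> : u - L h = - L (h - u *m J).
  by rewrite linearB /= mulmxK // opprB.
rewrite normrN; apply: le_trans (Lk _) _.
apply: (@le_trans _ _ (k * (eps' * `|u|))); first by rewrite ler_pM2l.
apply: (@le_trans _ _ (k * (eps' * (C' * `|h|)))).
  by rewrite ler_pM2l // ler_pM2l.
by rewrite /eps' le_eqVlt; apply/orP; left; apply/eqP; field; rewrite !gt_eqF.
Qed.

(** Bootstrap: the derivative of g is the inverse Jacobian of f evaluated at g, hence of class C^k
    as soon as g is, which makes g of class C^(k+1). *)
Lemma inverse_Ck (f g : 'rV[R]_n -> 'rV[R]_n) (G W : set 'rV[R]_n) (C : R) :
  open G -> open W -> (forall k, Ck_on k G f) ->
  (forall y, W y -> G (g y)) -> (forall y, W y -> jac f (g y) \in unitmx) ->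
  (forall y, W y -> f (g y) = y) ->
  (forall y z, W y -> W z -> `|g z - g y| <= C * `|z - y|) ->
  forall k, Ck_on k W g.
Proof.
move=> oG oW Cf WG uJ fg lg.
have df x : G x -> differentiable f x by have [H _] := Cf 1%N; exact: H.
have Hg y : W y -> differentiable g y /\
    forall v, 'D_v g y = v *m invmx (jac f (g y)).
  move=> Wy; apply: (@inverse_differentiable _ _ _ C); [exact/df/WG|exact: uJ|].
  by apply: filterS (open_nbhs_nbhs (conj oW Wy)) => z Wz; split; auto.
elim=> [|k IH] /=; first by move=> y /Hg[dg _]; apply: differentiable_continuous.
split=> [y /Hg[]//|v].
apply: (@Ck_on_ext _ _ _ _ _ (fun y => v *m invmx (jac f (g y)))) => //.
  by move=> y /set_mem /Hg[_ ->].
apply/Ck_onP => // j.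
rewrite (_ : (fun x => _) = fun x => \sum_i v 0 i * invmx (jac f (g x)) i j);
  last first.
  by apply/funext => x; rewrite mxE.
apply: Ck_fun_sum => // i; apply: Ck_funM => //; first exact: Ck_fun_cst.
apply: (Ck_fun_invmx oW uJ) => a b.
rewrite (_ : (fun x => _) = fun x => 'D_(delta_mx 0 a) f (g x) 0 b); last first.
  by apply/funext => x; rewrite mxE.
apply: (Ck_fun_comp oW oG WG IH (g := fun x => 'D_(delta_mx 0 a) f x 0 b)).
exact: ((Ck_onP _ _ oG).1 ((Cf k.+1).2 _) b).
Qed.

Theorem inverse_function (G : set 'rV[R]_n) (f : 'rV[R]_n -> 'rV[R]_n) e :
  open G -> G e -> (forall k, Ck_on k G f) -> (forall v, 'D_v f e = v) ->
  exists (O W : set 'rV[R]_n) (g : 'rV[R]_n -> 'rV[R]_n),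
  [/\ open O, open W, O e & O `<=` G] /\
  [/\ forall x, O x -> W (f x), forall y, W y -> O (g y),
      forall x, O x -> g (f x) = x, forall y, W y -> f (g y) = y &
      forall k, Ck_on k W g].
Proof.
move=> oG Ge Cf Dfe.
have /nbhs_ballP[r /= r0 Hr] := near_diff_bound oG Ge (Cf 1%N) Dfe.
have rG z : ball e r z -> G z by move=> /Hr[].
have df z : ball e r z -> differentiable f z.
  by move=> /rG Gz; have [H _] := Cf 1%N; exact: H.
have Df z v : ball e r z -> `|'D_v f z - v| <= 2^-1 * `|v|.
  by move=> /Hr[].
pose W := ball (f e) (r / 4); pose O := [set x | ball e r x /\ W (f x)].
(* The default value [e] is taken only where y has no preimage in the ball, hence never on [W]. *)
pose g y := xget e [set x | ball e r x /\ f x = y].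
have Wg y : W y -> ball e r (g y) /\ f (g y) = y.
  move=> /(near_id_surj r0 df Df)[x xr fx].
  by apply: (@xgetPex _ e [set x | ball e r x /\ f x = y]); exists x.
have oW : open W by exact: ball_open.
have exp := near_id_expansive df Df.
exists O, W, g; split; split=> //.
- rewrite openE => x [xr Wfx]; apply: filterI.
    exact: (open_nbhs_nbhs (conj (@ball_open _ _ e r) xr)).
  exact: (differentiable_continuous (df x xr) (open_nbhs_nbhs (conj oW Wfx))).
- by split; apply: ballxx => //; rewrite divr_gt0.
- by move=> x [/rG].
- by move=> x [].
- by move=> y Wy; have [gy fgy] := Wg y Wy; split; rewrite // fgy.
- move=> x [xr Wfx]; have [gr fg] := Wg _ Wfx.
  apply/eqP; rewrite -subr_eq0 -normr_le0; apply: le_trans (exp _ _ gr xr) _.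
  by rewrite fg subrr normr0 mulr0.
- by move=> y /Wg[].
apply: (@inverse_Ck f g G W 2) => // [y /Wg[/rG]//|y|y /Wg[]//|y z Wy Wz].
  (* A vector w killed by the Jacobian satisfies |w| <= |w|/2, so it is zero. *)
  move=> /Wg[gr _]; rewrite -row_free_unit -kermx_eq0; apply/eqP/row_matrixP => i.
  rewrite row0; set w := row i _.
  have : w *m jac f (g y) = 0 by apply/sub_kermxP; exact: row_sub.
  rewrite jacE; last exact: df.
  move=> Dw; have := Df _ w gr; rewrite Dw sub0r normrN => H.
  by apply/eqP; rewrite -normr_le0; move: H; lra.
have [[gy fgy] [gz fgz]] := (Wg y Wy, Wg z Wz).
by have := exp _ _ gz gy; rewrite fgy fgz.
Qed.

End InverseFunctionTheorem.

(** * Fibres of maps of constant rank *)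

Section ConstantRank.
Variables (R : realType) (n m : nat).

Lemma Ck_on_differentiable p q (G : set 'rV[R]_p) (f : 'rV[R]_p -> 'rV[R]_q) :
  (forall k, Ck_on k G f) -> forall x, G x -> differentiable f x.
Proof. by move=> Cf; have [H _] := Cf 1%N; exact: H. Qed.

Lemma Ck_onD p q k (G : set 'rV[R]_p) (f g : 'rV[R]_p -> 'rV[R]_q) : open G ->
  Ck_on k G f -> Ck_on k G g -> Ck_on k G (fun x => f x + g x).
Proof.
move=> oG /(Ck_onP _ _ oG) Cf /(Ck_onP _ _ oG) Cg; apply/Ck_onP => // i.
rewrite (_ : (fun x => _) = fun x => f x 0 i + g x 0 i); first exact: Ck_funD.
by apply/funext => x; rewrite mxE.
Qed.

Lemma Ck_on_cst p q k (G : set 'rV[R]_p) (c : 'rV[R]_q) : open G ->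
  Ck_on k G (fun=> c).
Proof. by move=> oG; apply/Ck_onP => // i; apply: Ck_fun_cst. Qed.

Lemma Ck_on_mulmxr p q s k (G : set 'rV[R]_p) (f : 'rV[R]_p -> 'rV[R]_q)
    (M : 'M[R]_(q, s)) : open G ->
  Ck_on k G f -> Ck_on k G (fun x => f x *m M).
Proof.
move=> oG Cf; apply: (@Ck_on_comp _ _ _ _ _ _ setT f (mulmxr M)) => //.
  exact: openT.
exact: Ck_on_linear openT.
Qed.

Lemma derive_mulmxr p q s (f : 'rV[R]_p -> 'rV[R]_q) (M : 'M[R]_(q, s)) x v :
  differentiable f x -> 'D_v (fun y => f y *m M) x = 'D_v f x *m M.
Proof.
move=> df; have cM : continuous (mulmxr M : 'rV[R]_q -> 'rV[R]_s).
  exact: linear_rV_continuous.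
have dM : differentiable (mulmxr M : 'rV[R]_q -> 'rV[R]_s) (f x).
  exact: linear_differentiable.
by rewrite (@derive_comp _ _ _ _ f (mulmxr M)) // deriveE // diff_lin.
Qed.

(* The hypothesis says that F intertwines right multiplication by M_B, which
   moves e to B, with some map T; by the chain rule D F has then the same rank
   at B as at e. *)
Theorem constant_rank_fiber (G : set 'rV[R]_n) (F : 'rV[R]_n -> 'rV[R]_m) e :
  open G -> G e -> (forall k, Ck_on k G F) ->
  (forall B, G B -> exists (M : 'M[R]_n) (T : 'rV[R]_m -> 'rV[R]_m),
    [/\ M \in unitmx, e *m M = B, differentiable T (F e) &
        \forall A \near e, F (A *m M) = T (F A)]) ->
  exists k (U : set 'rV[R]_k) (O : set 'rV[R]_n)
      (phi : 'rV[R]_k -> 'rV[R]_n) (P : 'M[R]_(n, k)),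
  [/\ open U, open O, O e & O `<=` G] /\
  [/\ forall k', Ck_on k' U phi,
      forall u, U u -> [/\ O (phi u), F (phi u) = F e & (phi u - e) *m P = u] &
      forall A, O A -> F A = F e -> exists2 u, U u & phi u = A].
Proof.
move=> oG Ge CF HG.
have dF := Ck_on_differentiable CF.
pose J := jac F e; pose K0 := kermx J.
pose i : 'M[R]_(\rank K0, n) := row_base K0.
have iK : i *m pinvmx i = 1%:M by apply: mulmxVp; exact: row_base_free.
pose p := pinvmx i *m i.
have ip : i *m p = i by rewrite mulmxA iK mul1mx.
have KP (x : 'rV[R]_n) : x *m J = 0 -> (x <= i)%MS.
  by move=> xJ; rewrite eq_row_base; apply/sub_kermxP.
have iJ : i *m J = 0.
  by apply/sub_kermxP; rewrite eq_row_base.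
have ipx (x : 'rV[R]_n) : (x <= i)%MS -> x *m p = x.
  by move=> /submxP[w ->]; rewrite -mulmxA ip.
have pp : p *m p = p by rewrite /p -mulmxA ip.
pose q := pinvmx J *m (1%:M - p).
have qp : q *m p = 0 by rewrite -mulmxA mulmxBl mul1mx pp subrr mulmx0.
have JqE : J *m q = 1%:M - p.
  apply/row_matrixP => a; rewrite mulmxA [LHS]rowE [RHS]rowE; set x := delta_mx _ _.
  apply/eqP; rewrite -subr_eq0 mulmxA -mulmxBl mulmxBr mulmx1 subr_eq0; apply/eqP.
  rewrite ipx //; apply: KP.
  by rewrite mulmxBl (mulmxA x J) mulmxKpV ?submxMl // subrr.
have pE : p = pinvmx i *m i by [].
have iE : (i :=: K0)%MS by exact: eq_row_base.
clearbody q p i K0.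
(* p is a projection onto ker D F(e) and q inverts D F(e) on a complement, so
   that D Phi(e) = id and ker D F(e) is a chart of the fibre through Phi. *)
pose Phi A := (A - e) *m p + (F A - F e) *m q.
have CPhi k : Ck_on k G Phi.
  apply: Ck_onD => //; apply: Ck_on_mulmxr => //; apply: Ck_onD => //;
    try exact: Ck_on_cst.
  exact: (@Ck_on_linear _ _ _ k G idfun oG).
have DPhi A v : G A -> 'D_v Phi A = v *m p + 'D_v F A *m q.
  move=> GA; have dFA := dF A GA.
  have dA : differentiable (fun A => A - e) A by [].
  have dFe : differentiable (fun A => F A - F e) A by apply: differentiableB.
  have dm r s (h : 'rV[R]_n -> 'rV[R]_r) (M : 'M[R]_(r, s)) :
      differentiable h A -> differentiable (fun y => h y *m M) A.
    move=> dh; apply: (@differentiable_comp _ _ _ _ h (mulmxr M)) => //.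
    by apply: linear_differentiable; exact: linear_rV_continuous.
  rewrite deriveD; try (apply/diff_derivable/dm => //).
  have E1 : 'D_v (fun A => A - e) A = v.
    by rewrite deriveB // derive_id derive_cst subr0.
  have E2 : 'D_v (fun A => F A - F e) A = 'D_v F A.
    by rewrite deriveB //; [rewrite derive_cst subr0|exact: diff_derivable].
  by rewrite (derive_mulmxr _ _ dA) (derive_mulmxr _ _ dFe) E1 E2.
have DPhie v : 'D_v Phi e = v.
  rewrite DPhi // -jacE; last exact: dF.
  by rewrite -mulmxA JqE mulmxBr mulmx1 addrC subrK.
have Phie : Phi e = 0 by rewrite /Phi !subrr !mul0mx addr0.
have [V1 [W1 [Psi [[oV1 oW1 V1e V1G] [PhiW PsiO PsiK PhiK CPsi]]]]] :=
  inverse_function oG Ge CPhi DPhie.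
have W10 : W1 0 by rewrite -Phie; apply: PhiW.
(* A ball rather than any neighbourhood: its convexity makes [U] star-shaped about 0, which later
   turns a zero derivative into constancy. *)
have /nbhs_ballP[r /= r0 Hr] := open_nbhs_nbhs (conj oW1 W10).
pose B0 := ball (0 : 'rV[R]_n) r.
have oB : open B0 by exact: ball_open.
pose U : set 'rV[R]_(\rank K0) := [set u | B0 (u *m i)].
have ci : continuous (mulmxr i : 'rV[R]_(\rank K0) -> 'rV[R]_n).
  exact: linear_rV_continuous.
have oU : open U by apply: (open_comp _ oB) => u _; exact: ci.
pose O := [set A | V1 A /\ B0 (Phi A)].
have oO : open O.
  rewrite openE => x [Vx Bx]; apply: filterI.
    exact: (open_nbhs_nbhs (conj oV1 Vx)).
  have := Ck_on_differentiable CPhi (V1G _ Vx).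
  by move=> /differentiable_continuous/(_ _ (open_nbhs_nbhs (conj oB Bx))).
pose phi u := Psi (u *m i).
have Cphi k' : Ck_on k' U phi.
  apply: (@Ck_on_comp _ _ _ _ _ _ W1 (mulmxr i) Psi) => //.
    by move=> u Uu; apply: Hr.
  exact: Ck_on_linear.
have phiO u : U u -> O (phi u).
  by move=> Uu; split; [apply/PsiO/Hr | rewrite /phi PhiK //; apply: Hr].
have Dcomp0 u v : U u -> 'D_v (fun u => F (phi u)) u = 0.
  move=> Uu; have [V1B _] := phiO u Uu; set B := phi u in V1B *.
  have GB := V1G _ V1B.
  have dphi : differentiable phi u by exact: Ck_on_differentiable Cphi _ _.
  have dPhiB : differentiable Phi B by exact: Ck_on_differentiable CPhi _ _.
  rewrite (@derive_comp _ _ _ _ phi F) //; last exact: dF.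
  set w := 'D_v phi u; rewrite -/B -jacE; last exact: dF.
  set JB := jac F B.
  (* Differentiate [Phi (phi u) = u *m i]. Multiplying the result by 1 - p, which kills [p] and [i]
     and fixes [q], then isolates the term in [q]. *)
  have wE : w *m p + w *m JB *m q = v *m i.
    rewrite jacE; last exact: dF.
    rewrite -DPhi // -(@derive_comp _ _ _ _ phi Phi) //.
    have : \forall z \near u, (Phi \o phi) z = z *m i.
      by apply: filterS (open_nbhs_nbhs (conj oU Uu)) => z Uz /=; apply/PhiK/Hr.
    move=> /near_eq_derive ->; rewrite (@derive_mulmxr _ _ _ idfun) //.
    by rewrite derive_id.
  have wq : w *m JB *m q = 0.
    have : (w *m p + w *m JB *m q) *m (1%:M - p) = v *m i *m (1%:M - p).
      by rewrite wE.
    have pp0 : p *m (1%:M - p) = 0 by rewrite mulmxBr mulmx1 pp subrr.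
    have qq : q *m (1%:M - p) = q by rewrite mulmxBr mulmx1 qp subr0.
    have ii : i *m (1%:M - p) = 0 by rewrite mulmxBr mulmx1 ip subrr.
    by rewrite mulmxDl -!mulmxA pp0 qq ii !mulmx0 add0r.
  (* ker (D F(B) q) contains ker D F(B), and p embeds it in ker D F(e), which
     has the dimension of ker D F(B): the two kernels coincide. *)
  pose N := kermx (JB *m q).
  have [M [T [uM eM dT FT]]] := HG B GB.
  (* By the chain rule in F(A M) = T(F A), the matrix M carries ker D F(e) into ker D F(B); since M
     is invertible, the kernel at B is at least as large. *)
  have KM : i *m M *m JB = 0.
    apply/row_matrixP => a; rewrite row0 !row_mul; set x := row a i.
    rewrite jacE; last exact: dF.
    have xJ : x *m J = 0 by rewrite -row_mul iJ row0.
    have dM y : differentiable (mulmxr M : 'rV[R]_n -> 'rV[R]_n) y.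
      by apply: linear_differentiable; exact: linear_rV_continuous.
    have dFB : differentiable F B by exact: dF.
    have DM : 'D_x (mulmxr M : 'rV[R]_n -> 'rV[R]_n) e = x *m M.
      by rewrite (@derive_mulmxr _ _ _ idfun) // derive_id.
    rewrite -DM -eM -(@derive_comp _ _ _ _ (mulmxr M) F) //=; last by rewrite /= eM.
    rewrite (@near_eq_derive _ _ _ _ (T \o F)) //.
    by rewrite (derive_comp _ (dF e Ge) dT) -(jacE _ (dF e Ge)) -/J xJ derive0.
  have rN : (\rank N <= \rank K0)%N.
    (* On [N] the derivative of [Phi] at B is [p], and that derivative is injective because [Psi] is
       a differentiable left inverse of [Phi] near B. *)
    have Npinj : (N :&: kermx p)%MS = 0.
      apply/eqP/rowV0P => x; rewrite sub_capmx.
      move=> /andP[/sub_kermxP xN /sub_kermxP xp].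
      have Dx : 'D_x Phi B = 0.
        rewrite DPhi // xp -jacE; last exact: dF.
        by rewrite -mulmxA xN addr0.
      have WB : W1 (Phi B) by apply: PhiW.
      have : 'D_x (Psi \o Phi) B = x.
        have : \forall z \near B, (Psi \o Phi) z = z.
          by apply: filterS (open_nbhs_nbhs (conj oV1 V1B)) => z Oz /=; apply: PsiK.
        by move=> /near_eq_derive ->; rewrite derive_id.
      rewrite derive_comp //; last exact: Ck_on_differentiable CPsi _ _.
      by rewrite Dx derive0 => <-.
    have <- : \rank (N *m p) = \rank N.
      by rewrite -(mxrank_mul_ker N p) Npinj mxrank0 addn0.
    by rewrite pE mulmxA (leq_trans (mxrankM_maxr _ _)) // iE.
  have KN : (kermx JB <= N)%MS.
    by apply/sub_kermxP; rewrite mulmxA mulmx_ker mul0mx.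
  have iM : \rank (i *m M) = \rank K0.
    by rewrite mxrankMfree ?row_free_unit //; exact: eqmx_rank (introT eqmxP iE).
  have rKB : (\rank K0 <= \rank (kermx JB))%N.
    by rewrite -iM; apply: mxrankS; apply/sub_kermxP.
  have sz : \rank (kermx JB) = \rank N.
    by apply/eqP; rewrite eqn_leq (mxrankS KN) (leq_trans rN rKB).
  have /eqmxP NE : (kermx JB == N)%MS.
    by rewrite -(mxrank_leqif_eq KN) sz eqxx.
  have wN : (w <= N)%MS by apply/sub_kermxP; rewrite mulmxA.
  by apply/sub_kermxP; rewrite NE.
have U0 : U 0 by rewrite /U /= mul0mx; apply: ballxx.
have phi0 : phi 0 = e by rewrite /phi mul0mx -Phie PsiK.
(* Mean value inequality with bound 0 on the segment from 0 to u. *)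
have Fphi u : U u -> F (phi u) = F e.
  move=> Uu; have Useg t : 0 <= t <= 1 -> U (0 + t *: (u - 0)).
    move=> t01; have := ball_segment Uu U0 t01.
    by rewrite /U /= mul0mx !add0r !subr0 -scalemxAl.
  have dFphi z : U z -> differentiable (fun u => F (phi u)) z.
    move=> Uz; apply: differentiable_comp.
      exact: Ck_on_differentiable Cphi _ _.
    by apply/dF/V1G; case: (phiO z Uz).
  have : `|F (phi u) - F (phi 0)| <= 0.
    apply: (@mean_value_rV _ _ _ (fun u => F (phi u)) 0 u 0) => // t /Useg Ut.
      exact: (dFphi _ Ut).
    by rewrite Dcomp0 // normr0.
  by rewrite normr_le0 subr_eq0 phi0 => /eqP.
(* The inverse chart is the restriction of an affine map: project onto the kernel, then read
   coordinates in the basis [i]. *)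
exists (\rank K0), U, O, phi, (p *m pinvmx i); split; split=> //.
- by split=> //; rewrite Phie; apply: ballxx.
- by move=> A [/V1G].
- move=> u Uu; split; [exact: phiO|exact: Fphi|].
  have H : (phi u - e) *m p = u *m i.
    by rewrite -(PhiK _ (Hr _ Uu)) -/(phi u) /Phi (Fphi u Uu) subrr mul0mx addr0.
  by rewrite mulmxA H -mulmxA iK mulmx1.
move=> A [VA BA] FA.
have PA : Phi A = (A - e) *m p by rewrite /Phi FA subrr mul0mx addr0.
have uE : (A - e) *m pinvmx i *m i = Phi A by rewrite PA -mulmxA -pE.
have Bu : B0 ((A - e) *m pinvmx i *m i) by rewrite uE.
exists ((A - e) *m pinvmx i) => //.
by rewrite /phi uE PsiK.
Qed.
End ConstantRank.

(** * Smooth maps between abstract vector spaces *)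

Section VectorSpaceSmoothness.
Variable R : realType.
Implicit Types U V W X : vectType R.

Lemma smooth_ext V W (O : set V) (f g : V -> W) : vopen O ->
  (forall x, O x -> f x = g x) -> smooth_on_open O f -> smooth_on_open O g.
Proof.
move=> oO fg Cf k; apply: Ck_on_ext (Cf k) => // x /set_mem Ox.
by rewrite fg.
Qed.

Lemma smooth_linear V W (O : set V) (f : {linear V -> W}) : vopen O ->
  smooth_on_open O f.
Proof. by move=> oO k; exact: (Ck_on_linear k (v2r \o f \o r2v) oO). Qed.

Lemma smooth_comp V W X (O : set V) (Q : set W) (f : V -> W) (g : W -> X) :
  vopen O -> vopen Q -> (forall x, O x -> Q (f x)) ->
  smooth_on_open O f -> smooth_on_open Q g -> smooth_on_open O (fun x => g (f x)).
Proof.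
move=> oO oQ OQ Cf Cg k.
have OQ' x : (r2v @^-1` O) x -> (r2v @^-1` Q) (v2r (f (r2v x))).
  by move=> Ox; rewrite /preimage /= v2rK; apply: OQ.
have := Ck_on_comp oO oQ OQ' (Cf k) (Cg k).
by apply: Ck_on_ext => // x _; rewrite v2rK.
Qed.

Lemma vopenT V : vopen (setT : set V).
Proof. by rewrite /vopen preimage_setT; apply: openT. Qed.

Lemma smooth_linear_comp V W X (O : set V) (f : V -> W) (g : {linear W -> X}) :
  vopen O -> smooth_on_open O f -> smooth_on_open O (fun x => g (f x)).
Proof.
move=> oO Cf; apply: (smooth_comp oO (@vopenT W)) => //.
exact/smooth_linear/vopenT.
Qed.

Lemma smooth_cst V W (O : set V) (c : W) : vopen O -> smooth_on_open O (fun=> c).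
Proof. by move=> oO k; apply: Ck_on_cst. Qed.

Lemma smoothD V W (O : set V) (f g : V -> W) : vopen O ->
  smooth_on_open O f -> smooth_on_open O g -> smooth_on_open O (fun x => f x + g x).
Proof.
move=> oO Cf Cg k; apply: Ck_on_ext (Ck_onD oO (Cf k) (Cg k)) => // x _.
by rewrite linearD.
Qed.

Lemma smoothN V W (O : set V) (f : V -> W) : vopen O ->
  smooth_on_open O f -> smooth_on_open O (fun x => - f x).
Proof. by move=> oO; exact: (@smooth_linear_comp V W W O f -%R oO). Qed.

Lemma smooth_sum V W (O : set V) (I : Type) (r : seq I) (f : I -> V -> W) :
  vopen O -> (forall i, smooth_on_open O (f i)) ->
  smooth_on_open O (fun x => \sum_(i <- r) f i x).
Proof.
move=> oO Cf; elim: r => [|i r IH].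
  by apply: smooth_ext (smooth_cst 0 oO) => // x _; rewrite big_nil.
by apply: smooth_ext (smoothD oO (Cf i) IH) => // x _; rewrite big_cons.
Qed.

Lemma smooth_pair V W X (O : set V) (f : V -> W) (g : V -> X) : vopen O ->
  smooth_on_open O f -> smooth_on_open O g ->
  smooth_on_open O (fun x => (f x, g x)).
Proof.
move=> oO Cf Cg.
have l1 : linear (fun w : W => (w, 0 : X)).
  by move=> a u v; rewrite [RHS]surjective_pairing /= scaler0 addr0.
have l2 : linear (fun w : X => (0 : W, w)).
  by move=> a u v; rewrite [RHS]surjective_pairing /= scaler0 addr0.
pose i1 : {linear W -> (W * X)%type} := HB.pack (fun w : W => (w, 0 : X))
  (GRing.isLinear.Build R W (W * X)%type *:%R _ l1).
pose i2 : {linear X -> (W * X)%type} := HB.pack (fun w : X => (0 : W, w))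
  (GRing.isLinear.Build R X (W * X)%type *:%R _ l2).
have := smoothD oO (smooth_linear_comp i1 oO Cf) (smooth_linear_comp i2 oO Cg).
by apply: smooth_ext => // x _; rewrite [LHS]surjective_pairing /= addr0 add0r.
Qed.

Lemma smooth_fst V W X (O : set V) (f : V -> (W * X)%type) : vopen O ->
  smooth_on_open O f -> smooth_on_open O (fun x => (f x).1).
Proof. by move=> oO; exact: (@smooth_linear_comp V _ W O f fst oO). Qed.

Lemma smooth_snd V W X (O : set V) (f : V -> (W * X)%type) : vopen O ->
  smooth_on_open O f -> smooth_on_open O (fun x => (f x).2).
Proof. by move=> oO; exact: (@smooth_linear_comp V _ X O f snd oO). Qed.

Lemma v2r_lfun U W (f : 'Hom(U, W)) u : v2r (f u) = v2r u *m f2mx f.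
Proof. by rewrite unlock /= r2vK. Qed.

Lemma smooth_eval V U W (O : set V) (f : V -> 'Hom(U, W)) u : vopen O ->
  smooth_on_open O f -> smooth_on_open O (fun x => f x u).
Proof.
move=> oO Cf; have l : linear (fun h : 'Hom(U, W) => h u).
  by move=> a h h'; rewrite add_lfunE scale_lfunE.
pose ev : {linear 'Hom(U, W) -> W} := HB.pack (fun h : 'Hom(U, W) => h u)
  (GRing.isLinear.Build R 'Hom(U, W) W *:%R _ l).
exact: (smooth_linear_comp ev oO Cf).
Qed.

Lemma Ck_fun_f2mx V U W (O : set V) (f : V -> 'Hom(U, W)) k i j : vopen O ->
  smooth_on_open O f -> Ck_fun k (r2v @^-1` O) (fun x => f2mx (f (r2v x)) i j).
Proof.
move=> oO Cf; have Ci := smooth_eval (r2v (delta_mx 0 i)) oO Cf.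
rewrite (_ : (fun x => _) = fun x => v2r (f (r2v x) (r2v (delta_mx 0 i))) 0 j).
  exact: ((Ck_onP _ _ oO).1 (Ci k) j).
by apply/funext => x; rewrite v2r_lfun r2vK -rowE mxE.
Qed.

Lemma smooth_app V U W (O : set V) (f : V -> 'Hom(U, W)) (u : V -> U) : vopen O ->
  smooth_on_open O f -> smooth_on_open O u -> smooth_on_open O (fun x => f x (u x)).
Proof.
move=> oO Cf Cu k; apply/Ck_onP => // j.
rewrite (_ : (fun x => _) =
    fun x => \sum_i v2r (u (r2v x)) 0 i * f2mx (f (r2v x)) i j).
  apply: Ck_fun_sum => // i; apply: Ck_funM => //; last exact: Ck_fun_f2mx.
  exact: ((Ck_onP _ _ oO).1 (Cu k) i).
by apply/funext => x; rewrite v2r_lfun mxE.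
Qed.

(** A linear map is a linear function of its values on a basis: [IO i] sends w to the map u |-> u_i
    w, and f is the sum of the [IO i] at these values. *)
Lemma smooth_hom V U W (O : set V) (f : V -> 'Hom(U, W)) : vopen O ->
  (forall u, smooth_on_open O (fun x => f x u)) -> smooth_on_open O f.
Proof.
move=> oO Cf.
pose h i (w : W) (u : U) := v2r u 0 i *: w.
have lh i w : linear (h i w).
  by move=> a u v; rewrite /h linearP !mxE scalerDl scalerA.
pose io i (w : W) : 'Hom(U, W) := linfun (h i w).
have lio i : linear (io i).
  move=> a v w; apply/lfunP => u; rewrite add_lfunE scale_lfunE !linfun_funE //.
  by rewrite /h scalerDr !scalerA mulrC.
pose IO i : {linear W -> 'Hom(U, W)} := HB.pack (io i)
  (GRing.isLinear.Build R W 'Hom(U, W) *:%R _ (lio i)).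
have := smooth_sum (index_enum 'I_(dim U)) oO (fun i =>
   smooth_linear_comp (IO i) oO (Cf (r2v (delta_mx 0 i)))).
apply: smooth_ext => // x _; apply/lfunP => u; rewrite sum_lfunE.
rewrite -[in RHS](v2rK u) [in RHS](row_sum_delta (v2r u)) !linear_sum.
by apply: eq_bigr => i _; rewrite linfun_funE // /h !linearZ.
Qed.

Lemma f2mx_unit U (f : 'Hom(U, U)) : (f2mx f \in unitmx) = (lker f == 0%VS).
Proof.
rewrite -row_free_unit; apply/idP/lker0P => [uf u v fuv|inj].
  by apply/v2r_inj/(row_free_inj uf); rewrite -!v2r_lfun fuv.
rewrite -kermx_eq0; apply/rowV0P => x /sub_kermxP xf.
by apply/r2v_inj/inj/v2r_inj; rewrite linear0 !v2r_lfun !r2vK linear0 mul0mx.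
Qed.

Lemma smooth_inv V U (O : set V) (f : V -> 'Hom(U, U)) : vopen O ->
  (forall x, O x -> lker (f x) == 0%VS) ->
  smooth_on_open O f -> smooth_on_open O (fun x => (f x)^-1%VF).
Proof.
move=> oO uf Cf; apply: smooth_hom => // u k; apply/Ck_onP => // j.
apply: (@Ck_fun_ext _ _ _ _
    (fun x => \sum_i v2r u 0 i * invmx (f2mx (f (r2v x))) i j)) => //.
  move=> x /set_mem Ox.
  (* The inverse of a linear map is defined through a pseudo-inverse matrix, which is the true
     inverse when the kernel is trivial. *)
  by rewrite v2r_lfun /inv_lfun /= pinvmxE ?f2mx_unit ?uf // mxE.
apply: Ck_fun_sum => // i; apply: Ck_funM => //; first exact: Ck_fun_cst.
apply: Ck_fun_invmx => // [x Ox|a b]; first by rewrite f2mx_unit uf.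
exact: Ck_fun_f2mx.
Qed.

(** The kernel is trivial exactly where the determinant, a continuous function, does not vanish. *)
Lemma vopen_lker0 V U (f : V -> 'Hom(U, U)) : smooth_on_open setT f ->
  vopen [set x | lker (f x) == 0%VS].
Proof.
move=> Cf; pose D (x : 'rV[R]_(dim V)) := \det (f2mx (f (r2v x))).
have cD : continuous D.
  move=> x; apply: (@Ck_fun_det _ _ 0 setT _ (fun x => f2mx (f (r2v x)))) => //.
    exact: openT.
  move=> i j; have := @Ck_fun_f2mx V U U setT f 0 i j (@vopenT V) Cf.
  by rewrite preimage_setT.
rewrite /vopen (_ : _ @^-1` _ = D @^-1` [set y | y != 0]).
  by apply: open_comp => [x _|]; [exact: cD|exact: open_neq].
apply/seteqP; split=> x /=; rewrite -f2mx_unit unitmxE unitfE //.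
Qed.

Lemma smooth_on_of V W (O S : set V) (f : V -> W) : vopen O -> S `<=` O ->
  smooth_on_open O f -> smooth_on S f.
Proof. by move=> oO SO Cf x /SO Ox; exists O, f. Qed.

Lemma open_submanifold V (M : set V) : vopen M -> smooth_submanifold M.
Proof.
move=> oM; exists V => x Mx; exists M, M, id, id.
have Cid : smooth_on_open M (@id V) by exact: (smooth_linear idfun oM).
split=> //; split=> //.
- exact: smooth_on_of Cid.
- by apply: smooth_on_of Cid => // y [].
by rewrite image_id setIid.
Qed.
End VectorSpaceSmoothness.

(** * The action of invertible triples on structures *)

Section Multilinear.
Variable R : realType.
Implicit Types U V W X : vectType R.

Lemma linearD_fun U V (f g : U -> V) :
  linear f -> linear g -> linear (fun x => f x + g x).
Proof. by move=> lf lg a u v; rewrite lf lg scalerDr addrACA. Qed.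

Lemma linear_lfun U V W (h : 'Hom(V, W)) (f : U -> V) :
  linear f -> linear (fun x => h (f x)).
Proof. by move=> lf a u v; rewrite lf linearP. Qed.

Lemma linear_lfunl U V W (f : U -> 'Hom(V, W)) w :
  linear f -> linear (fun x => f x w).
Proof. by move=> lf a u v; rewrite lf add_lfunE scale_lfunE. Qed.

Lemma linear_id_fun U : linear (fun x : U => x).
Proof. by []. Qed.

Lemma linearN_fun U V (f : U -> V) : linear f -> linear (fun x => - f x).
Proof. by move=> lf a u v; rewrite lf opprD scalerN. Qed.

Definition linfun3 U V W X (f : U -> V -> W -> X) :
    'Hom(U, 'Hom(V, 'Hom(W, X))) :=
  linfun (fun x => linfun2 (f x)).

Lemma linfun3E U V W X (f : U -> V -> W -> X) :
  (forall x y, linear (f x y)) -> (forall x z, linear (fun y => f x y z)) ->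
  (forall y z, linear (fun x => f x y z)) ->
  forall x y z, linfun3 f x y z = f x y z.
Proof.
move=> l1 l2 l3 x y z; rewrite /linfun3 linfun_funE.
  by apply: linfun2E => [u|v]; [exact: l1|exact: l2].
move=> a u v; apply/lfunP => s; apply/lfunP => t.
rewrite !add_lfunE !scale_lfunE !linfun2E //; try exact: l3; move=> w; exact: l2.
Qed.
End Multilinear.

Ltac multilinear := repeat first
  [ exact: linear_id_fun | apply: linearD_fun | apply: linearN_fun
  | apply: linear_lfun | apply: linear_lfunl ].

Section LfunAdditive.
Variables (R : realType) (U V : vectType R) (f : 'Hom(U, V)).

Lemma lfunD x y : f (x + y) = f x + f y. Proof. exact: linearD. Qed.
Lemma lfunN x : f (- x) = - f x. Proof. exact: linearN. Qed.
Lemma lfun0 : f 0 = 0. Proof. exact: linear0. Qed.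
Lemma v2rD (x y : U) : v2r (x + y) = v2r x + v2r y. Proof. exact: linearD. Qed.
Lemma v2rN (x : U) : v2r (- x) = - v2r x. Proof. exact: linearN. Qed.
Lemma v2r0 : v2r (0 : U) = 0. Proof. exact: linear0. Qed.
End LfunAdditive.

Ltac lfun_expand := do 3 rewrite ?(lfunD, lfunN, lfun0)
  ?(add_lfunE, opp_lfunE, zero_lfunE).

(** Proves additive identities between values of linear maps: expand by linearity, treat the
    remaining values as atoms, and compare coordinates, where [ring] applies. *)
Ltac abel :=
  lfun_expand;
  repeat match goal with |- context [fun_of_lfun ?f ?x] =>
    let y := fresh in set y := (fun_of_lfun f x); clearbody y end;
  apply: v2r_inj; rewrite ?(v2rD, v2rN, v2r0);
  apply/rowP => ?; rewrite ?mxE; ring.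

(** * Pull-back of raw structures and its functoriality *)

Section Pullback.
Variables (R : realType) (g : lie2algebra R).
Implicit Types A B C : triple g g.

(* Raw data (d, br, bra, l3) not subject to any axiom; the last component only
   serves to express the skew-symmetry of the third entry of a triple. *)
Definition structures : vectType R :=
  ('Hom(gm1 g, g0 g) * 'Hom(g0 g, 'Hom(g0 g, g0 g)) *
   'Hom(g0 g, 'Hom(gm1 g, gm1 g)) *
   'Hom(g0 g, 'Hom(g0 g, 'Hom(g0 g, gm1 g))) *
   'Hom(g0 g, 'Hom(g0 g, gm1 g)))%type.
Implicit Types (s : structures) (de : 'Hom(gm1 g, g0 g)).
Implicit Types (be : 'Hom(g0 g, 'Hom(g0 g, g0 g))).
Implicit Types (si : 'Hom(g0 g, 'Hom(g0 g, gm1 g))).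
Implicit Types (ga : 'Hom(g0 g, 'Hom(gm1 g, gm1 g))).
Implicit Types (la : 'Hom(g0 g, 'Hom(g0 g, 'Hom(g0 g, gm1 g)))).

(** For endomorphisms of finite-dimensional spaces, trivial kernels amount to bijectivity. *)
Definition invertible A := (lker (hom0 A) == 0%VS) && (lker (hom1 A) == 0%VS).

(** This and the next three definitions solve the homomorphism equations for the source: for
    invertible A with A_2 skew-symmetric, they give the structure that makes A a homomorphism to the
    given one. *)
Definition pull_d A de :=
  linfun (fun a => (hom0 A)^-1%VF (de (hom1 A a))).
Definition pull_br A de be :=
  linfun2 (fun x y =>
    (hom0 A)^-1%VF (be (hom0 A x) (hom0 A y) + de (hom2 A x y))).
Definition pull_bra A de ga :=
  linfun2 (fun x a =>
    (hom1 A)^-1%VF (ga (hom0 A x) (hom1 A a) + hom2 A x (pull_d A de a))).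
(* The formula uses A_2(z, [x, y]) instead of - A_2([x, y], z): in this form
   pulling back is functorial without assuming A_2 skew-symmetric. *)
Definition pull_l3 A de be ga la :=
  linfun3 (fun x y z => (hom1 A)^-1%VF
    (ga (hom0 A x) (hom2 A y z) + ga (hom0 A y) (hom2 A z x)
     + ga (hom0 A z) (hom2 A x y) + la (hom0 A x) (hom0 A y) (hom0 A z)
     + hom2 A z (pull_br A de be x y) + hom2 A x (pull_br A de be y z)
     + hom2 A y (pull_br A de be z x))).
(** The value 0 is fixed exactly when A_2 is skew-symmetric; the term in [si] makes the assignment
    compatible with composition. *)
Definition pull_sym A si :=
  linfun2 (fun x y =>
    (hom1 A)^-1%VF (si (hom0 A x) (hom0 A y) + hom2 A x y + hom2 A y x)).

Lemma pull_dE A de a : pull_d A de a = (hom0 A)^-1%VF (de (hom1 A a)).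
Proof. by apply: linfun_funE; multilinear. Qed.

Lemma pull_brE A de be x y : pull_br A de be x y =
  (hom0 A)^-1%VF (be (hom0 A x) (hom0 A y) + de (hom2 A x y)).
Proof. by apply: linfun2E => z; multilinear. Qed.

Lemma pull_braE A de ga x a : pull_bra A de ga x a =
  (hom1 A)^-1%VF (ga (hom0 A x) (hom1 A a) + hom2 A x (pull_d A de a)).
Proof. by apply: linfun2E => z; multilinear. Qed.

Lemma pull_l3E A de be ga la x y z : pull_l3 A de be ga la x y z =
  (hom1 A)^-1%VF
    (ga (hom0 A x) (hom2 A y z) + ga (hom0 A y) (hom2 A z x)
     + ga (hom0 A z) (hom2 A x y) + la (hom0 A x) (hom0 A y) (hom0 A z)
     + hom2 A z (pull_br A de be x y) + hom2 A x (pull_br A de be y z)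
     + hom2 A y (pull_br A de be z x)).
Proof. by apply: linfun3E => u v; multilinear. Qed.

Lemma pull_symE A si x y : pull_sym A si x y =
  (hom1 A)^-1%VF (si (hom0 A x) (hom0 A y) + hom2 A x y + hom2 A y x).
Proof. by apply: linfun2E => z; multilinear. Qed.

Definition pull A s : structures :=
  let: (de, be, ga, la, si) := s in
  (pull_d A de, pull_br A de be, pull_bra A de ga, pull_l3 A de be ga la,
   pull_sym A si).

Lemma inv_lfunK (U : vectType R) (f : 'Hom(U, U)) : lker f == 0%VS ->
  cancel f^-1%VF f.
Proof. by move=> kf; exact: lker0_lfunVK. Qed.

Lemma inv_lfun_comp (U : vectType R) (f h : 'Hom(U, U)) :
  lker f == 0%VS -> lker h == 0%VS -> (f \o h)^-1%VF = (h^-1 \o f^-1)%VF.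
Proof.
move=> kf kh; apply/lfunP => u; rewrite comp_lfunE.
have kfh : lker (f \o h)%VF == 0%VS.
  apply/lker0P => x y; rewrite !comp_lfunE => /(lker0P kf)/(lker0P kh).
  by [].
apply: (lker0P kfh); rewrite inv_lfunK // comp_lfunE !inv_lfunK //.
Qed.

(** A right action on the whole space of structures. Once the outer inverse of [hom1 B] is removed
    and [hom1 A] is applied to both sides, no inverse is left and the components are sums to be
    compared. *)
Lemma pull_comp A B s : invertible A -> invertible B ->
  pull (hom_comp A B) s = pull B (pull A s).
Proof.
move=> /andP[kA0 kA1] /andP[kB0 kB1]; case: s => [[[[de be] ga] la] si].
have A0K := inv_lfunK kA0; have A1K := inv_lfunK kA1.
have B0K := inv_lfunK kB0; have B1K := inv_lfunK kB1.
have C0 : hom0 (hom_comp A B) = (hom0 A \o hom0 B)%VF by [].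
have C1 : hom1 (hom_comp A B) = (hom1 A \o hom1 B)%VF by [].
have C0V := inv_lfun_comp kA0 kB0; have C1V := inv_lfun_comp kA1 kB1.
have Ed : pull_d (hom_comp A B) de = pull_d B (pull_d A de).
  by apply/lfunP => a; rewrite !pull_dE C0 C1 C0V !comp_lfunE.
have Ebr : pull_br (hom_comp A B) de be = pull_br B (pull_d A de) (pull_br A de be).
  apply/lfunP => x; apply/lfunP => y.
  rewrite !pull_brE C0 C0V !comp_lfunE hom_comp2E !pull_dE.
  by rewrite [de (_ + _)]linearD addrA [in LHS](linearD (hom0 A)^-1%VF).
(* The composite bracket occurs inside [hom2 (hom_comp A B)], where its image under [hom0 B] has to
   be known. *)
have Bbr x y : hom0 B (pull_br (hom_comp A B) de be x y) =
    pull_br A de be (hom0 B x) (hom0 B y) + pull_d A de (hom2 B x y).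
  by rewrite Ebr pull_brE B0K.
have Bd a : hom0 B (pull_d (hom_comp A B) de a) = pull_d A de (hom1 B a).
  by rewrite Ed pull_dE B0K.
rewrite /pull Ed Ebr; congr (_, _, _, _, _).
- apply/lfunP => x; apply/lfunP => a.
  rewrite !pull_braE -Ed C0 C1 C1V !comp_lfunE hom_comp2E Bd.
  congr ((hom1 B)^-1%VF _); apply: (lker0P kA1).
  by rewrite A1K [RHS]linearD /= A1K addrA.
- apply/lfunP => x; apply/lfunP => y; apply/lfunP => z.
  rewrite !pull_l3E -Ebr C0 C1 C1V !comp_lfunE !hom_comp2E !Bbr !pull_braE.
  congr ((hom1 B)^-1%VF _); apply: (lker0P kA1).
  rewrite A1K !(linearD (hom1 A)) /= !A1K.
  abel.
apply/lfunP => x; apply/lfunP => y.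
rewrite !pull_symE C0 C1 C1V !comp_lfunE !hom_comp2E.
congr ((hom1 B)^-1%VF _); apply: (lker0P kA1).
rewrite A1K !(linearD (hom1 A)) /= !A1K.
abel.
Qed.
End Pullback.

(** * Automorphisms as the stabilizer of the structure of g *)

Section Automorphisms.
Variables (R : realType) (g : lie2algebra R).
Implicit Types A B C : triple g g.

Definition structure0 : structures g := (d g, br g, bra g, l3 g, 0).

Lemma tripleP A B : (forall x, hom0 A x = hom0 B x) ->
  (forall a, hom1 A a = hom1 B a) -> (forall x y, hom2 A x y = hom2 B x y) ->
  A = B.
Proof.
case: A B => [[A0 A1] A2] [[B0 B1] B2]; rewrite /hom0 /hom1 /hom2 /=.
move=> /lfunP -> /lfunP -> E2; congr (_, _, _).
by apply/lfunP => x; apply/lfunP => y; exact: E2.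
Qed.

Lemma hom_comp0E A B x : hom0 (hom_comp A B) x = hom0 A (hom0 B x).
Proof. by rewrite [hom0 _]/(_ \o _)%VF comp_lfunE. Qed.

Lemma hom_comp1E A B a : hom1 (hom_comp A B) a = hom1 A (hom1 B a).
Proof. by rewrite [hom1 _]/(_ \o _)%VF comp_lfunE. Qed.

Lemma hom_id0E x : hom0 (hom_id g) x = x.
Proof. exact: id_lfunE. Qed.

Lemma hom_id1E a : hom1 (hom_id g) a = a.
Proof. exact: id_lfunE. Qed.

Lemma hom_id2E x y : hom2 (hom_id g) x y = 0.
Proof. by rewrite /hom2 /= !zero_lfunE. Qed.

Definition homE :=
  (hom_comp0E, hom_comp1E, @hom_comp2E, hom_id0E, hom_id1E, hom_id2E).

Lemma hom_compA A B C : hom_comp A (hom_comp B C) = hom_comp (hom_comp A B) C.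
Proof. by apply: tripleP => *; rewrite !homE // linearD addrA. Qed.

Lemma hom_comp1l A : hom_comp (hom_id g) A = A.
Proof. by apply: tripleP => *; rewrite !homE // add0r. Qed.

Lemma hom_comp1r A : hom_comp A (hom_id g) = A.
Proof. by apply: tripleP => *; rewrite !homE // linear0 addr0. Qed.

Definition hom_inv A : triple g g :=
  ((hom0 A)^-1%VF, (hom1 A)^-1%VF,
   linfun2 (fun x y =>
     - (hom1 A)^-1%VF (hom2 A ((hom0 A)^-1%VF x) ((hom0 A)^-1%VF y)))).

Lemma hom_inv2E A x y : hom2 (hom_inv A) x y =
  - (hom1 A)^-1%VF (hom2 A ((hom0 A)^-1%VF x) ((hom0 A)^-1%VF y)).
Proof. by apply: linfun2E => z; multilinear. Qed.

Lemma hom_invr A : invertible A -> hom_comp A (hom_inv A) = hom_id g.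
Proof.
move=> /andP[k0 k1]; apply: tripleP => *.
- by rewrite !homE inv_lfunK.
- by rewrite !homE inv_lfunK.
by rewrite !homE hom_inv2E linearN /= inv_lfunK // subrr.
Qed.

Lemma hom_invl A : invertible A -> hom_comp (hom_inv A) A = hom_id g.
Proof.
move=> /andP[k0 k1]; apply: tripleP => *.
- by rewrite !homE lker0_lfunK.
- by rewrite !homE lker0_lfunK.
by rewrite !homE hom_inv2E !lker0_lfunK // addNr.
Qed.

Lemma comp_id_lker0 A B : hom_comp B A = hom_id g -> invertible A.
Proof.
move=> BA; apply/andP; split; apply/lker0P => x y xy.
  by rewrite -[x]hom_id0E -[y]hom_id0E -BA !hom_comp0E xy.
by rewrite -[x]hom_id1E -[y]hom_id1E -BA !hom_comp1E xy.
Qed.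

Lemma invertible_inv A : invertible A -> invertible (hom_inv A).
Proof. by move=> uA; apply: comp_id_lker0 (hom_invr uA). Qed.

Lemma invertible_id : invertible (hom_id g).
Proof. by apply: comp_id_lker0 (hom_comp1l (hom_id g)). Qed.

Lemma invertible_comp A B : invertible A -> invertible B ->
  invertible (hom_comp A B).
Proof.
move=> uA uB; apply: (@comp_id_lker0 _ (hom_comp (hom_inv B) (hom_inv A))).
by rewrite hom_compA -(hom_compA (hom_inv B)) hom_invl // hom_comp1r hom_invl.
Qed.

Lemma pull_id s : pull (hom_id g) s = s.
Proof.
case: s => [[[[de be] ga] la] si]; rewrite /pull.
have [k0 k1] := andP invertible_id.
have i0 x : (hom0 (hom_id g))^-1%VF x = x.
  by apply: (lker0P k0); rewrite inv_lfunK ?hom_id0E.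
have i1 x : (hom1 (hom_id g))^-1%VF x = x.
  by apply: (lker0P k1); rewrite inv_lfunK ?hom_id1E.
congr (_, _, _, _, _).
- by apply/lfunP => a; rewrite pull_dE i0 hom_id1E.
- apply/lfunP => x; apply/lfunP => y.
  by rewrite pull_brE i0 !homE linear0 addr0.
- apply/lfunP => x; apply/lfunP => y.
  by rewrite pull_braE i1 !homE addr0.
- apply/lfunP => x; apply/lfunP => y; apply/lfunP => z.
  by rewrite pull_l3E i1 !homE !linear0 !addr0 !add0r.
apply/lfunP => x; apply/lfunP => y.
by rewrite pull_symE i1 !homE !addr0.
Qed.

(** Component by component the fixed-point equation is a homomorphism axiom. The fifth gives
    skew-symmetry, which turns A_2(z, [x, y]) back into - A_2([x, y], z). *)
Lemma lie2hom_pull A : invertible A ->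
  is_lie2hom A <-> pull A structure0 = structure0.
Proof.
move=> /andP[k0 k1]; have K0 := inv_lfunK k0; have K1 := inv_lfunK k1.
split=> [[sk hd hb ha hl]|].
  rewrite /pull /structure0.
  have dE a : hom0 A (d g a) = d g (hom1 A a) by rewrite -!comp_lfunE hd.
  have Ed : pull_d A (d g) = d g.
    by apply/lfunP => a; apply: (lker0P k0); rewrite pull_dE K0 dE.
  have Eb : pull_br A (d g) (br g) = br g.
    apply/lfunP => x; apply/lfunP => y; apply: (lker0P k0).
    by rewrite pull_brE K0 -hb addrC subrK.
  rewrite Ed Eb; congr (_, _, _, _, _).
  - apply/lfunP => x; apply/lfunP => a; apply: (lker0P k1).
    by rewrite pull_braE K1 Ed -ha addrC subrK.
  - apply/lfunP => x; apply/lfunP => y; apply/lfunP => z; apply: (lker0P k1).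
    rewrite pull_l3E K1 Eb hl (sk z (br g x y)) (sk x (br g y z)) (sk y (br g z x)).
    abel.
  apply/lfunP => x; apply/lfunP => y; apply: (lker0P k1).
  by rewrite pull_symE K1 !zero_lfunE add0r (sk y) subrr linear0.
move=> [Ed Eb Ea El Es].
have sk x y : hom2 A x y = - hom2 A y x.
  have := congr1 (fun f : 'Hom(_, 'Hom(_, _)) => hom1 A (f x y)) Es.
  rewrite pull_symE K1 !zero_lfunE linear0 add0r => /eqP.
  by rewrite addr_eq0 => /eqP.
have dE a : hom0 A (d g a) = d g (hom1 A a) by rewrite -{1}Ed pull_dE K0.
split=> //.
- by apply/lfunP => a; rewrite !comp_lfunE dE.
- by move=> x y; rewrite -{1}Eb pull_brE K0 addrC addKr.
- by move=> x a; rewrite -{1}Ea pull_braE K1 Ed addrC addKr.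
move=> x y z; rewrite -[in RHS]El pull_l3E K1 Eb.
rewrite (sk z (br g x y)) (sk x (br g y z)) (sk y (br g z x)).
abel.
Qed.

(** The inverse triple is again a homomorphism: if A fixes the structure then so does its inverse,
    since pull-back is an action. *)
Lemma lie2autP A : is_lie2aut A <-> invertible A /\ pull A structure0 = structure0.
Proof.
split=> [[hA [B [_ BA _]]]|[uA EA]].
  have uA : invertible A by apply: (@comp_id_lker0 A B).
  by split=> //; apply/lie2hom_pull.
split; first exact/lie2hom_pull.
exists (hom_inv A); split; [|exact: hom_invl|exact: hom_invr].
apply/lie2hom_pull; first exact: invertible_inv.
rewrite -[in LHS]EA -pull_comp ?invertible_inv //.
by rewrite hom_invr // pull_id.
Qed.

Lemma lie2aut_comp A B : is_lie2aut A -> is_lie2aut B -> is_lie2aut (hom_comp A B).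
Proof.
move=> /lie2autP[uA EA] /lie2autP[uB EB]; apply/lie2autP; split.
  exact: invertible_comp.
by rewrite pull_comp // EA.
Qed.

Lemma lie2aut_inv A : is_lie2aut A -> is_lie2aut (hom_inv A).
Proof.
move=> /lie2autP[uA EA]; apply/lie2autP; split; first exact: invertible_inv.
rewrite -[in LHS]EA -pull_comp ?invertible_inv //.
by rewrite hom_invr // pull_id.
Qed.

Lemma Aut0_group : is_group (Aut0 g).
Proof.
split=> /=.
- exact: lie2aut_comp.
- by apply/lie2autP; split; [exact: invertible_id | exact: pull_id].
- by move=> A B C _ _ _; exact: hom_compA.
- by move=> A _; exact: hom_comp1l.
- by move=> A _; exact: hom_comp1r.
move=> A autA; exists (hom_inv A); have [uA _] := (lie2autP A).1 autA.
by split; [exact: lie2aut_inv|exact: hom_invr|exact: hom_invl].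
Qed.

(** [ginv] is obtained by choice; uniqueness of inverses identifies it with any explicit formula. *)
Lemma ginvE (G : groupData R) (x y : gamb G) : is_group G ->
  gset x -> gset y -> gmul x y = gone G -> gmul y x = gone G -> ginv x = y.
Proof.
move=> grG Gx Gy xy yx; rewrite /ginv.
set P := [set z | _].
have [Gz xz zx] : P (xget 0 P) by apply: (@xgetPex _ 0 P); exists y.
rewrite -[LHS](group_mulr1 grG) // -xy (group_mulA grG) // zx.
exact: group_mul1.
Qed.

Lemma ginv_Aut0 A : is_lie2aut A -> @ginv R (Aut0 g) A = hom_inv A.
Proof.
move=> autA; have [uA _] := (lie2autP A).1 autA.
apply: (@ginvE (Aut0 g)) => //=; [exact: Aut0_group|exact: lie2aut_inv| |].
  exact: hom_invr.
exact: hom_invl.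
Qed.
End Automorphisms.

Ltac smooth := repeat first
  [ eassumption | exact: smooth_cst | exact: vopenT | apply: smoothD
  | apply: smoothN | apply: smooth_app ].

(** * Smooth dependence of composition, inversion and pull-back on parameters *)

Section PullSmooth.
Variables (R : realType) (g : lie2algebra R) (W : vectType R) (O : set W).
Hypothesis oO : vopen O.

Lemma smooth_lfun2 (U V X : vectType R) (f : W -> 'Hom(U, 'Hom(V, X))) :
  (forall x y, smooth_on_open O (fun w => f w x y)) -> smooth_on_open O f.
Proof. by move=> Cf; apply: smooth_hom => // x; apply: smooth_hom. Qed.

Lemma smooth_comp_lfun (U V X : vectType R) (f : W -> 'Hom(V, X))
    (h : W -> 'Hom(U, V)) :
  smooth_on_open O f -> smooth_on_open O h ->
  smooth_on_open O (fun w => (f w \o h w)%VF).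
Proof.
move=> Cf Ch; apply: smooth_hom => // x.
apply: (@smooth_ext _ _ _ _ (fun w => f w (h w x))) => // [w _|].
  by rewrite comp_lfunE.
by smooth.
Qed.

Lemma smooth_triple (A0 : W -> 'Hom(g0 g, g0 g)) (A1 : W -> 'Hom(gm1 g, gm1 g))
    (A2 : W -> 'Hom(g0 g, 'Hom(g0 g, gm1 g))) :
  smooth_on_open O A0 -> smooth_on_open O A1 -> smooth_on_open O A2 ->
  @smooth_on_open R W (triple g g) O (fun w => (A0 w, A1 w, A2 w)).
Proof. by move=> C0 C1 C2; do 2![apply: smooth_pair => //]. Qed.

Variables (A : W -> triple g g).
Hypothesis CA : smooth_on_open O A.

Lemma smooth_hom0 : smooth_on_open O (fun w => hom0 (A w)).
Proof. by do 2!apply: smooth_fst => //. Qed.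

Lemma smooth_hom1 : smooth_on_open O (fun w => hom1 (A w)).
Proof. by apply: smooth_snd => //; apply: smooth_fst. Qed.

Lemma smooth_hom2 : smooth_on_open O (fun w => hom2 (A w)).
Proof. exact: smooth_snd. Qed.

Lemma smooth_hom_comp (B : W -> triple g g) : smooth_on_open O B ->
  smooth_on_open O (fun w => hom_comp (A w) (B w)).
Proof.
move=> CB; have C0 := smooth_hom0; have C1 := smooth_hom1; have C2 := smooth_hom2.
have D0 : smooth_on_open O (fun w => hom0 (B w)) by do 2!apply: smooth_fst => //.
have D1 : smooth_on_open O (fun w => hom1 (B w)).
  by apply: smooth_snd => //; apply: smooth_fst.
have D2 : smooth_on_open O (fun w => hom2 (B w)) by exact: smooth_snd.
apply: smooth_triple; [exact: smooth_comp_lfun|exact: smooth_comp_lfun|].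
apply: smooth_lfun2 => x y.
apply: (@smooth_ext _ _ _ _ (fun w => hom2 (A w) (hom0 (B w) x) (hom0 (B w) y)
   + hom1 (A w) (hom2 (B w) x y))) => // [w _|].
  by rewrite -hom_comp2E.
by smooth.
Qed.

Hypothesis uA : forall w, O w -> invertible (A w).

Lemma smooth_hom0V : smooth_on_open O (fun w => (hom0 (A w))^-1%VF).
Proof. by apply: smooth_inv => // [w /uA /andP[]|] //; exact: smooth_hom0. Qed.

Lemma smooth_hom1V : smooth_on_open O (fun w => (hom1 (A w))^-1%VF).
Proof. by apply: smooth_inv => // [w /uA /andP[]|] //; exact: smooth_hom1. Qed.

Lemma smooth_hom_inv : smooth_on_open O (fun w => hom_inv (A w)).
Proof.
have C2 := smooth_hom2; have V0 := smooth_hom0V; have V1 := smooth_hom1V.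
apply: smooth_triple => //; apply: smooth_lfun2 => x y.
apply: (@smooth_ext _ _ _ _ (fun w => - (hom1 (A w))^-1%VF
  (hom2 (A w) ((hom0 (A w))^-1%VF x) ((hom0 (A w))^-1%VF y)))) => // [w _|].
  by rewrite -hom_inv2E.
by smooth.
Qed.

(** Both arguments vary with w: a constant structure gives the orbit map, a constant triple gives
    the intertwining map of the rank theorem. *)
Lemma smooth_pull (s : W -> structures g) : smooth_on_open O s ->
  smooth_on_open O (fun w => pull (A w) (s w)).
Proof.
move=> Cs; have C0 := smooth_hom0; have C1 := smooth_hom1; have C2 := smooth_hom2.
have V0 := smooth_hom0V; have V1 := smooth_hom1V.
pose de w := (s w).1.1.1.1; pose be w := (s w).1.1.1.2.
pose ga w := (s w).1.1.2; pose la w := (s w).1.2; pose si w := (s w).2.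
have Cs1 := smooth_fst oO Cs; have Cs2 := smooth_fst oO Cs1.
have Cs3 := smooth_fst oO Cs2.
have Cde : smooth_on_open O de := smooth_fst oO Cs3.
have Cbe : smooth_on_open O be := smooth_snd oO Cs3.
have Cga : smooth_on_open O ga := smooth_snd oO Cs2.
have Cla : smooth_on_open O la := smooth_snd oO Cs1.
have Csi : smooth_on_open O si := smooth_snd oO Cs.
have E w : pull (A w) (s w) =
    (pull_d (A w) (de w), pull_br (A w) (de w) (be w),
     pull_bra (A w) (de w) (ga w),
     pull_l3 (A w) (de w) (be w) (ga w) (la w), pull_sym (A w) (si w)).
  by rewrite /de /be /ga /la /si; case: (s w) => [[[[? ?] ?] ?] ?].
have Dd : smooth_on_open O (fun w => pull_d (A w) (de w)).
  apply: smooth_hom => // a; apply: (@smooth_ext _ _ _ _ (fun w =>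
    (hom0 (A w))^-1%VF (de w (hom1 (A w) a)))) => // [w _|].
    by rewrite pull_dE.
  by smooth.
have Db : smooth_on_open O (fun w => pull_br (A w) (de w) (be w)).
  apply: smooth_lfun2 => x y.
  apply: smooth_ext oO (fun w _ => esym (pull_brE (A w) (de w) (be w) x y)) _.
  by smooth.
apply: (smooth_ext oO (fun w _ => esym (E w))).
apply: smooth_pair => //; first apply: smooth_pair => //;
  first apply: smooth_pair => //; first exact: smooth_pair.
- apply: smooth_lfun2 => x y.
  apply: smooth_ext oO (fun w _ => esym (pull_braE (A w) (de w) (ga w) x y)) _.
  by smooth.
- apply: smooth_hom => // x; apply: smooth_lfun2 => y z.
  apply: smooth_ext oO
    (fun w _ => esym (pull_l3E (A w) (de w) (be w) (ga w) (la w) x y z)) _.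
  by smooth.
apply: smooth_lfun2 => x y.
apply: smooth_ext oO (fun w _ => esym (pull_symE (A w) (si w) x y)) _.
by smooth.
Qed.
End PullSmooth.

(** * The Lie group of automorphisms *)

Section AutomorphismManifold.
Variable R : realType.

(** Row vectors have their own topology and the one read through [r2v]; the two agree because [r2v]
    is linear. *)
Lemma vopen_rV k (U : set 'rV[R]_k) : open U -> @vopen R 'rV[R]_k U.
Proof.
move=> oU; apply: open_comp => // x _.
exact: (@linear_rV_continuous R _ k (r2v : {linear 'rV_(dim 'rV[R]_k) -> 'rV[R]_k})).
Qed.

Lemma smooth_rV k (V : vectType R) (U : set 'rV[R]_k)
    (phi : 'rV[R]_k -> 'rV[R]_(dim V)) :
  open U -> (forall j, Ck_on j U phi) ->
  @smooth_on_open R 'rV[R]_k V U (fun u => r2v (phi u)).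
Proof.
move=> oU Cphi j; have oU' := vopen_rV oU.
have := @Ck_on_comp R _ _ _ j _ U (r2v : 'rV_(dim 'rV[R]_k) -> 'rV[R]_k) phi
  oU' oU (fun x Ux => Ux) (Ck_on_linear _ _ oU') (Cphi j).
by apply: Ck_on_ext => // x _; rewrite r2vK.
Qed.

Lemma vopenI (V : vectType R) (O Q : set V) : vopen O -> vopen Q -> vopen (O `&` Q).
Proof. by rewrite /vopen preimage_setI; exact: openI. Qed.

Lemma vopen_preimage (V W : vectType R) (O : set V) (Q : set W) (f : V -> W) :
  vopen O -> smooth_on_open O f -> vopen Q -> vopen (O `&` f @^-1` Q).
Proof.
move=> oO Cf oQ; rewrite /vopen openE => x [Ox Qx]; apply: filterI.
  exact: (open_nbhs_nbhs (conj oO Ox)).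
have Qx' : (r2v @^-1` Q) (v2r (f (r2v x))) by rewrite /preimage /= v2rK.
have H : nbhs x [set y | (r2v @^-1` Q) (v2r (f (r2v y)))].
  exact: (Cf 0%N x Ox _ (open_nbhs_nbhs (conj oQ Qx'))).
by apply: (filterS _ H) => y; rewrite /preimage /= v2rK.
Qed.

Variable g : lie2algebra R.
Implicit Types A B : triple g g.

Lemma vopen_invertible : vopen (@invertible R g).
Proof.
have Cid : smooth_on_open setT (@id (triple g g)).
  exact: (smooth_linear idfun (@vopenT R _)).
have -> : (@invertible R g : set (triple g g)) =
    [set A | lker (hom0 A) == 0%VS] `&` [set A | lker (hom1 A) == 0%VS].
  by apply/seteqP; split=> A /= /andP.
apply: vopenI.
  exact: (vopen_lker0 (smooth_hom0 (@vopenT R _) Cid)).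
exact: (vopen_lker0 (smooth_hom1 (@vopenT R _) Cid)).
Qed.

Definition hom_rmul B A := hom_comp A B.

(** In B_2(A_0 x, A_0 y) + B_1 A_2(x, y) the left factor B enters linearly and the right factor A
    quadratically, hence the choice of right translations. *)
Lemma hom_rmul_linear B : linear (hom_rmul B).
Proof.
have h0 a A A' x : hom0 (a *: A + A') x = a *: hom0 A x + hom0 A' x.
  by rewrite [hom0 _]/(a *: hom0 A + hom0 A') add_lfunE scale_lfunE.
have h1 a A A' x : hom1 (a *: A + A') x = a *: hom1 A x + hom1 A' x.
  by rewrite [hom1 _]/(a *: hom1 A + hom1 A') add_lfunE scale_lfunE.
have h2 a A A' x y : hom2 (a *: A + A') x y = a *: hom2 A x y + hom2 A' x y.
  by rewrite [hom2 _]/(a *: hom2 A + hom2 A') !(add_lfunE, scale_lfunE).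
move=> a A A'; apply: tripleP => *.
- by rewrite h0 !hom_comp0E h0.
- by rewrite h1 !hom_comp1E h1.
by rewrite h2 !hom_comp2E h1 h2 scalerDr addrACA.
Qed.

HB.instance Definition _ B :=
  GRing.isLinear.Build R (triple g g) (triple g g) *:%R (hom_rmul B)
    (hom_rmul_linear B).

Definition rmul_mx B : 'M[R]_(dim (triple g g)) :=
  lin1_mx (v2r \o hom_rmul B \o r2v).

Lemma mul_rmul_mx B A : v2r A *m rmul_mx B = v2r (hom_comp A B).
Proof. by rewrite mul_rV_lin1 /= v2rK. Qed.

Lemma rmul_mx_unit B : invertible B -> rmul_mx B \in unitmx.
Proof.
move=> uB; suff : rmul_mx B *m rmul_mx (hom_inv B) = 1%:M by case/mulmx1_unit.
apply/eqP/mulmxP => u; rewrite mulmxA mulmx1 -[u]r2vK !mul_rmul_mx.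
by rewrite -hom_compA hom_invr // hom_comp1r.
Qed.

Lemma Aut0_chart : exists k (U : set 'rV[R]_k) (O : set (triple g g))
    (phi : 'rV[R]_k -> triple g g) (psi : triple g g -> 'rV[R]_k),
  [/\ open U, vopen O & O (hom_id g)] /\
  [/\ @smooth_on_open R 'rV[R]_k _ U phi, @smooth_on_open R _ 'rV[R]_k setT psi,
      forall u, U u -> [/\ O (phi u), is_lie2aut (phi u) & psi (phi u) = u] &
      forall A, O A -> is_lie2aut A -> exists2 u, U u & phi u = A].
Proof.
pose I : set (triple g g) := @invertible R g.
have oI : vopen I := vopen_invertible.
pose F x := v2r (pull (r2v x) (structure0 g)).
have CF k : Ck_on k (r2v @^-1` I) F.
  have Cid := smooth_linear idfun oI.
  exact: (smooth_pull oI Cid (fun w Ow => Ow) (smooth_cst _ oI) k).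
have Ie : (r2v @^-1` I) (v2r (hom_id g)).
  by rewrite /preimage /= v2rK; exact: invertible_id.
have [|k [U [Q [phi [P [[oU oO Oe OI] [Cphi Uphi Ophi]]]]]]] :=
    constant_rank_fiber oI Ie CF.
  (* M is right multiplication by B and T is pull-back by B. Functoriality intertwines them at every
     invertible triple, hence near the identity. *)
  move=> B uB; exists (rmul_mx (r2v B)), (fun y => v2r (pull (r2v B) (r2v y))).
  split; [exact: rmul_mx_unit| by rewrite mul_rmul_mx hom_comp1l r2vK| |].
    have oT := @vopenT R (structures g).
    have := smooth_pull oT (smooth_cst (r2v B) oT) (fun _ _ => uB)
      (smooth_linear idfun oT) 1.
    by move=> [H _]; exact: H.
  apply: filterS (open_nbhs_nbhs (conj oI Ie)) => A uA.
  by rewrite /F -{1}[A]r2vK mul_rmul_mx !v2rK pull_comp.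
have FE x : (r2v @^-1` I) x -> F x = F (v2r (hom_id g)) <-> is_lie2aut (r2v x).
  move=> Ix; rewrite lie2autP /F v2rK pull_id; split=> [/v2r_inj//|[_ ->]//].
exists k, U, (v2r @^-1` Q), (fun u => r2v (phi u)),
  (fun A => (v2r A - v2r (hom_id g)) *m P); split; split.
- by [].
- rewrite /vopen (_ : _ @^-1` _ = Q) //.
  by apply/seteqP; split=> x; rewrite /preimage /= r2vK.
- by [].
- exact: smooth_rV.
- have oT := @vopenT R (triple g g).
  apply: (@smooth_ext _ _ _ _ (fun A => v2r A *m P - v2r (hom_id g) *m P)) => //.
    by move=> A _; rewrite mulmxBl.
  apply: smoothD => //; last exact: smooth_cst.
  exact: (smooth_linear (mulmxr P \o v2r) oT).
- move=> u Uu; have [Ou Fu Pu] := Uphi u Uu.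
  rewrite /preimage /= r2vK; split=> //.
  exact: ((FE _ (OI _ Ou)).1 Fu).
move=> A OA autA; have IA : (r2v @^-1` I) (v2r A) by exact: OI.
have [|u Uu uA] := Ophi (v2r A) OA; last by exists u; rewrite // uA v2rK.
by apply/(FE _ IA); rewrite v2rK.
Qed.

(** All charts are right translates of the one at the identity, so they share the single model space
    that the definition of a submanifold demands. *)
Lemma Aut0_submanifold : smooth_submanifold (@is_lie2aut R g).
Proof.
have [k [U [Q [phi [psi [[oU oQ Qe] [Cphi Cpsi Uphi Qphi]]]]]]] := Aut0_chart.
have oT := @vopenT R (triple g g); have oU' := vopen_rV oU.
exists 'rV[R]_k => x autx.
have [ux _] := (lie2autP x).1 autx; have autV := lie2aut_inv autx.
have Crx (W : vectType R) (S : set W) (f : W -> triple g g)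
      (y : triple g g) :
    vopen S -> smooth_on_open S f -> smooth_on_open S (fun w => hom_comp (f w) y).
  by move=> oS Cf; exact: (smooth_hom_comp oS Cf (smooth_cst y oS)).
have CV := Crx _ _ _ (hom_inv x) oT (smooth_linear idfun oT).
have xK A : hom_comp (hom_comp A x) (hom_inv x) = A.
  by rewrite -hom_compA hom_invr // hom_comp1r.
have xVK A : hom_comp (hom_comp A (hom_inv x)) x = A.
  by rewrite -hom_compA hom_invl // hom_comp1r.
exists U, [set A | Q (hom_comp A (hom_inv x))], (fun u => hom_comp (phi u) x),
  (fun A => psi (hom_comp A (hom_inv x))); split; split.
- by [].
- by have := vopen_preimage oT CV oQ; rewrite setTI.
- by rewrite /= hom_invr.
- by apply: (smooth_on_of oU') => //; exact: Crx.
- by apply: (smooth_on_of oT) => //; exact: (smooth_comp oT oT).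
- apply/seteqP; split=> [_ [u Uu <-]|A [autA QA]].
    have [Qu autu _] := Uphi u Uu; split; first exact: lie2aut_comp.
    by rewrite /= xK.
  have [|u Uu uA] := Qphi _ QA; first exact: lie2aut_comp.
  by exists u; rewrite // uA xVK.
by move=> u Uu; rewrite xK; have [] := Uphi u Uu.
Qed.

Lemma Aut0_lie_group : is_lie_group (Aut0 g).
Proof.
have oT := @vopenT R (triple g g * triple g g)%type.
have autI A : is_lie2aut A -> invertible A by move=> /lie2autP[].
split.
- exact: Aut0_group.
- exact: Aut0_submanifold.
- apply: (smooth_on_of oT) => //.
  have Cid := smooth_linear idfun oT.
  exact: (smooth_hom_comp oT (smooth_fst oT Cid) (smooth_snd oT Cid)).
(* The explicit inverse is smooth on the open set of all invertible triples and extends the group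
   inverse there. *)
move=> A autA; exists (@invertible R g), (@hom_inv R g).
split; [exact: vopen_invertible|exact: autI| |].
  have oI := vopen_invertible.
  exact: (smooth_hom_inv oI (smooth_linear idfun oI)).
by move=> B uB autB; rewrite ginv_Aut0.
Qed.
End AutomorphismManifold.

(** * The crossed module *)

Section CrossedModule.
Variables (R : realType) (g : lie2algebra R).
Implicit Types (t s h k : 'Hom(g0 g, gm1 g)) (A B : triple g g).

Lemma starE t s x : star t s x = t x + s x + t (d g (s x)).
Proof. by rewrite /star !add_lfunE !comp_lfunE. Qed.

Lemma starA t s h : star t (star s h) = star (star t s) h.
Proof. by apply/lfunP => x; rewrite !starE; abel. Qed.

Lemma star0l t : star 0 t = t.
Proof. by apply/lfunP => x; rewrite starE !zero_lfunE add0r addr0. Qed.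

Lemma star0r t : star t 0 = t.
Proof. by apply/lfunP => x; rewrite starE !zero_lfunE !linear0 !addr0. Qed.

(** * The group of units for the star product *)

Definition one_dt t : 'Hom(g0 g, g0 g) := (\1 + (d g \o t))%VF.

Lemma one_dtE t x : one_dt t x = x + d g (t x).
Proof. by rewrite /one_dt add_lfunE id_lfunE comp_lfunE. Qed.

Lemma one_dt_star t s x : one_dt (star t s) x = one_dt t (one_dt s x).
Proof. by rewrite !one_dtE starE; abel. Qed.

Definition star_inv t := - (t \o (one_dt t)^-1)%VF.

Lemma star_invE t x : star_inv t x = - t ((one_dt t)^-1%VF x).
Proof. by rewrite /star_inv opp_lfunE comp_lfunE. Qed.

Lemma star_invr t : lker (one_dt t) == 0%VS -> star t (star_inv t) = 0.
Proof.
move=> kt; apply/lfunP => x; rewrite starE star_invE zero_lfunE.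
have {1}-> : x = one_dt t ((one_dt t)^-1%VF x) by rewrite inv_lfunK.
rewrite one_dtE; abel.
Qed.

Lemma star_invl t : lker (one_dt t) == 0%VS -> star (star_inv t) t = 0.
Proof.
move=> kt; apply/lfunP => x; rewrite starE !star_invE zero_lfunE.
have e : (one_dt t)^-1%VF (d g (t x)) = x - (one_dt t)^-1%VF x.
  by rewrite -{2}[x](lker0_lfunK kt) one_dtE linearD addrC addKr.
rewrite e; abel.
Qed.

Lemma Autm1P t : gset (t : gamb (Autm1 g)) <-> lker (one_dt t) == 0%VS.
Proof.
split=> [[s [ts st]]|kt].
  apply/lker0P => x y xy.
  have H z : one_dt s (one_dt t z) = z.
    by rewrite -one_dt_star st one_dtE zero_lfunE linear0 addr0.
  by rewrite -[x]H -[y]H xy.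
by exists (star_inv t); rewrite star_invr ?star_invl.
Qed.

Lemma star_closed t s : gset (t : gamb (Autm1 g)) -> gset (s : gamb (Autm1 g)) ->
  gset (star t s : gamb (Autm1 g)).
Proof.
move=> /Autm1P kt /Autm1P ks; apply/Autm1P/lker0P => x y.
by rewrite !one_dt_star => /(lker0P kt)/(lker0P ks).
Qed.

Lemma Autm1_group : is_group (Autm1 g).
Proof.
split=> /=.
- exact: star_closed.
- by exists 0; rewrite star0l.
- by move=> t s h _ _ _; exact: starA.
- by move=> t _; exact: star0l.
- by move=> t _; exact: star0r.
move=> t [s [ts st]]; exists s; split=> //.
by exists t; split.
Qed.

Lemma ginv_Autm1 t : gset (t : gamb (Autm1 g)) -> @ginv R (Autm1 g) t = star_inv t.
Proof.
move=> Gt; have kt := (Autm1P t).1 Gt.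
apply: (@ginvE R (Autm1 g)) => //=.
- exact: Autm1_group.
- by exists t; rewrite star_invr ?star_invl.
- exact: star_invr.
exact: star_invl.
Qed.

Lemma smooth_one_dt (W : vectType R) (O : set W) (t : W -> 'Hom(g0 g, gm1 g)) :
  vopen O -> smooth_on_open O t -> smooth_on_open O (fun w => one_dt (t w)).
Proof.
move=> oO Ct; apply: smoothD => //; first exact: smooth_cst.
by apply: smooth_comp_lfun => //; exact: smooth_cst.
Qed.

Lemma vopen_Autm1 : vopen (@gset R (Autm1 g)).
Proof.
have -> : @gset R (Autm1 g) = [set t | lker (one_dt t) == 0%VS].
  by apply/seteqP; split=> t /Autm1P.
have oT := @vopenT R 'Hom(g0 g, gm1 g).
exact: (vopen_lker0 (smooth_one_dt oT (smooth_linear idfun oT))).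
Qed.

Lemma Autm1_lie_group : is_lie_group (Autm1 g).
Proof.
have oT := @vopenT R ('Hom(g0 g, gm1 g) * 'Hom(g0 g, gm1 g))%type.
have oG := vopen_Autm1.
split.
- exact: Autm1_group.
- exact: open_submanifold.
- apply: (smooth_on_of oT) => //; have Cid := smooth_linear idfun oT.
  have C1 := smooth_fst oT Cid; have C2 := smooth_snd oT Cid.
  apply: smoothD => //; first exact: smoothD.
  apply: smooth_comp_lfun => //; apply: smooth_comp_lfun => //.
  exact: smooth_cst.
move=> t Gt; exists (@gset R (Autm1 g)), star_inv.
split=> // [|s Gs _]; last by rewrite ginv_Autm1.
have Cid := smooth_linear idfun oG.
apply: smoothN => //; apply: smooth_comp_lfun => //.
by apply: smooth_inv => // [s /Autm1P //|]; exact: smooth_one_dt.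
Qed.

(** * The boundary map into the automorphisms *)

Lemma partial0E t x : hom0 (aut_partial t) x = x + d g (t x).
Proof. exact: one_dtE. Qed.

Lemma partial1E t a : hom1 (aut_partial t) a = a + t (d g a).
Proof. by rewrite /hom1 /= add_lfunE id_lfunE comp_lfunE. Qed.

Lemma partial2E t x y : hom2 (aut_partial t) x y =
  t (br g x y) - bra g x (t y) + bra g y (t x) + bra g (d g (t y)) (t x).
Proof. by rewrite /hom2 /= ltauE /brl !opprK. Qed.

Definition partialE := (partial0E, partial1E, partial2E).

(** Only the third component involves the brackets; there d[x, a] = [x, da], [da, b] = [a, db] and
    skew-symmetry bring both sides to the same terms. *)
Lemma partial_star t s :
  aut_partial (star t s) = hom_comp (aut_partial t) (aut_partial s).
Proof.
apply: tripleP => [x|a|x y]; rewrite !homE !partialE !starE; [abel|abel|].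
lfun_expand.
rewrite !d_bra (br_skew y (d g (s x))) (br_skew (d g (s y)) (d g (s x))).
rewrite (bra_d (t y) (s x)) (bra_d (t (d g (s y))) (s x)).
abel.
Qed.

Lemma l3_cyc x y z : l3 g x y z = l3 g y z x.
Proof. by rewrite l3_skew12 l3_skew23 opprK. Qed.

Lemma bra_br x y (a : gm1 g) :
  bra g (br g x y) a - (bra g x (bra g y a) - bra g y (bra g x a) - l3 g x y (d g a))
  = 0.
Proof.
have /eqP := bra_jacobi x y a; rewrite -subr_eq0 => /eqP H.
by rewrite -[RHS]H; abel.
Qed.

(** The Jacobi identity for (x, dc, b), with [[x, dc], b] = [d[x, c], b] = - [db, [x, c]]. *)
Lemma bra_bra_d x (b c : gm1 g) :
  bra g x (bra g (d g c) b) - bra g (d g c) (bra g x b) + bra g (d g b) (bra g x c)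
  + l3 g x (d g b) (d g c) = 0.
Proof.
rewrite -[RHS]oppr0 -(bra_br x (d g c) b) -d_bra (bra_d (bra g x c) b).
by rewrite (l3_skew23 x (d g b)); abel.
Qed.

Lemma bra_d_bra_d (a b c : gm1 g) :
  bra g (d g a) (bra g (d g c) b) + bra g (d g b) (bra g (d g a) c)
  + bra g (d g c) (bra g (d g b) a) + l3 g (d g a) (d g b) (d g c) = 0.
Proof. by rewrite -(bra_bra_d (d g a) b c) (bra_d a b); abel. Qed.

(** The condition on l_3 holds degree by degree in t: the linear part is [J1], [J2], [J3] together
    with t applied to the Jacobi identity ([J]), the quadratic part is [K1], [K2], [K3], and the
    cubic part is [K]. *)
Lemma partial_hom t : is_lie2hom (aut_partial t : triple g g).
Proof.
split.
- by move=> x y; rewrite !partialE (br_skew y x) (bra_d (t x)); abel.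
- by apply/lfunP => a; rewrite !comp_lfunE !partialE; abel.
- move=> x y; rewrite !partialE; lfun_expand.
  by rewrite !d_bra (br_skew y) (br_skew (d g (t y)) (d g (t x))); abel.
- move=> x a; rewrite !partialE; lfun_expand.
  by rewrite !d_bra (bra_d a) (bra_d (t (d g a)) (t x)); abel.
move=> x y z; rewrite !partialE; lfun_expand.
pose D u := d g (t u).
(* Values of [l3] count as atoms in the final computation, so cyclic rotations first bring their
   arguments to a common order. *)
rewrite (l3_cyc (D x) y z) (l3_cyc x (D y) z) (l3_cyc (D y) z x).
rewrite (l3_cyc (D x) y (D z)) (l3_cyc (D x) (D y) z) (l3_cyc (D y) z (D x)) /D.
have J1 := bra_br x y (t z); have J2 := bra_br y z (t x).
have J3 := bra_br z x (t y).
have K1 := bra_bra_d x (t y) (t z); have K2 := bra_bra_d y (t z) (t x).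
have K3 := bra_bra_d z (t x) (t y); have K := bra_d_bra_d (t x) (t y) (t z).
have J : t (br g (br g x y) z) + t (br g (br g y z) x) + t (br g (br g z x) y)
    + t (d g (l3 g x y z)) = 0.
  by rewrite -!lfunD br_jacobi addNr lfun0.
(* The difference of the two sides is the sum of the vanishing expressions above, with [J] negated;
   0 is replaced by that sum. *)
apply/subr0_eq.
have Z (p q : gm1 g) : p = 0 -> q = 0 -> p + q = 0 by move=> -> ->; rewrite addr0.
have JN := congr1 -%R J; rewrite oppr0 in JN.
have ZJ := Z _ _ (Z _ _ J1 J2) (Z _ _ J3 JN).
have ZK := Z _ _ (Z _ _ K1 K2) (Z _ _ K3 K).
rewrite -[RHS](Z _ _ ZJ ZK).
abel.
Qed.

Lemma partial0 : aut_partial 0 = hom_id g.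
Proof.
apply: tripleP => *; rewrite !homE !partialE !zero_lfunE ?linear0 ?addr0 //.
Qed.

Lemma partial_aut t : gset (t : gamb (Autm1 g)) ->
  is_lie2aut (aut_partial t : triple g g).
Proof.
move=> [s [ts st]]; split; first exact: partial_hom.
exists (aut_partial s); split; first exact: partial_hom.
  by rewrite -partial_star st partial0.
by rewrite -partial_star ts partial0.
Qed.

(** * The action of automorphisms *)

Lemma actE A t x : aut_act A t x = hom1 A (t ((hom0 A)^-1%VF x)).
Proof. by rewrite /aut_act !comp_lfunE. Qed.

Lemma lie2aut_d A a : is_lie2aut A -> hom0 A (d g a) = d g (hom1 A a).
Proof. by move=> [[_ hd _ _ _] _]; rewrite -!comp_lfunE hd. Qed.

Lemma lie2aut_invertible A : is_lie2aut A -> invertible A.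
Proof. by move=> /lie2autP[]. Qed.

(** The quadratic term is preserved because A_0 d = d A_1: the middle of A_1 t A_0^-1 d A_1 s A_0^-1
    collapses to t d s. *)
Lemma act_star A t s : is_lie2aut A ->
  aut_act A (star t s) = star (aut_act A t) (aut_act A s).
Proof.
move=> autA; have /andP[k0 _] := lie2aut_invertible autA.
apply/lfunP => x; rewrite !(actE, starE) -(lie2aut_d _ autA) lker0_lfunK //.
by rewrite !lfunD.
Qed.

Lemma act_closed_star A t : is_lie2aut A -> gset (t : gamb (Autm1 g)) ->
  gset (aut_act A t : gamb (Autm1 g)).
Proof.
move=> autA [s [ts st]]; exists (aut_act A s).
have a0 : aut_act A 0 = 0 by apply/lfunP => x; rewrite actE !zero_lfunE lfun0.
by rewrite -!act_star // ts st a0.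
Qed.

Lemma aut_partial_smooth :
  @smooth_on_open R (gamb (Autm1 g)) (gamb (Aut0 g)) setT (@aut_partial R g).
Proof.
have oT := @vopenT R 'Hom(g0 g, gm1 g); have Cid := smooth_linear idfun oT.
apply: (smooth_triple oT).
- exact: (smooth_one_dt oT Cid).
- apply: smoothD => //; first exact: smooth_cst.
  by apply: smooth_comp_lfun => //; exact: smooth_cst.
apply: (smooth_lfun2 oT) => x y.
apply: (@smooth_ext _ _ _ _ (fun t : 'Hom(g0 g, gm1 g) => t (br g x y)
  + - bra g x (t y) + bra g y (t x) + bra g (d g (t y)) (t x))) => // [t _|].
  by rewrite ltauE /brl !opprK.
have Ct u : smooth_on_open setT (fun t : 'Hom(g0 g, gm1 g) => t u).
  exact: smooth_eval.
by do ?apply: smoothD => //; do ?apply: smoothN => //; do ?apply: smooth_app => //;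
  exact: smooth_cst.
Qed.

Lemma aut_partial_lie_hom : is_lie_group_hom (@aut_partial R g).
Proof.
split=> [t|t s _ _|]; [exact: partial_aut|exact: partial_star|].
by apply: smooth_on_of aut_partial_smooth => //; exact: vopenT.
Qed.

Lemma aut_act_lie_action : is_lie_action (@aut_act R g).
Proof.
split.
- by move=> A t /= autA; exact: act_closed_star.
- move=> t _; apply/lfunP => x; rewrite actE /= hom_id1E; congr (t _).
  have [k0 _] := andP (@invertible_id R g).
  by rewrite -[LHS]hom_id0E inv_lfunK.
- move=> A B t /lie2aut_invertible/andP[kA _] /lie2aut_invertible/andP[kB _] _.
  have C0 : hom0 (hom_comp A B) = (hom0 A \o hom0 B)%VF by [].
  apply/lfunP => x; rewrite !actE hom_comp1E /= C0.
  by rewrite inv_lfun_comp // comp_lfunE.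
- by move=> A t s /= autA _ _; exact: act_star.
have oI := @vopen_invertible R g.
have oT := @vopenT R (triple g g * 'Hom(g0 g, gm1 g))%type.
have CT := smooth_linear idfun oT.
(* The formula for the action is smooth on the open set of pairs whose first entry is invertible. *)
have oO := vopen_preimage oT (smooth_fst oT CT) oI; rewrite setTI in oO.
apply: (smooth_on_of oO); first by move=> [A t] [/= /lie2aut_invertible].
have Cid := smooth_linear idfun oO.
have CA := smooth_fst oO Cid; have Ct := smooth_snd oO Cid.
apply: smooth_comp_lfun => //; first apply: smooth_comp_lfun => //.
  exact: (smooth_hom1 oO CA).
exact: (smooth_hom0V oO CA).
Qed.

(** Equivariance with A moved to the other side, so that the third component of the inverse of A
    never has to be expanded. *)
Lemma partial_act A t : is_lie2aut A ->
  hom_comp (aut_partial (aut_act A t)) A = hom_comp A (aut_partial t).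
Proof.
move=> autA; have [[sk _ hb ha _] _] := autA.
have /andP[k0 _] := lie2aut_invertible autA; have K := lker0_lfunK k0.
have dA a := lie2aut_d a autA.
apply: tripleP => [x|a|x y]; rewrite !homE !partialE !actE ?K.
- by rewrite -dA lfunD.
- by rewrite -dA K lfunD.
have ha' u a : bra g (hom0 A u) (hom1 A a) = hom1 A (bra g u a) - hom2 A u (d g a).
  by rewrite -ha opprB addrC subrK.
rewrite -hb -!dA !ha'; lfun_expand.
rewrite !K (sk y) (sk (d g (t y)) (d g (t x))).
abel.
Qed.

End CrossedModule.

Theorem theorem4p4 (R : realType) (g : lie2algebra R) :
  lie_crossed_module (H1 := Autm1 g) (H0 := Aut0 g)
    (@aut_partial R g) (@aut_act R g).
Proof.
split.
- exact: Autm1_lie_group.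
- exact: Aut0_lie_group.
- exact: aut_partial_lie_hom.
- exact: aut_act_lie_action.
- move=> A t autA _; have uA := lie2aut_invertible autA.
  rewrite ginv_Aut0 //= -partial_act // -hom_compA hom_invr //.
  by rewrite hom_comp1r.
move=> t s Gt Gs; have kt := (Autm1P t).1 Gt; have K := inv_lfunK kt.
rewrite ginv_Autm1 //; apply/lfunP => x; rewrite actE /= partial1E !starE !star_invE.
rewrite [hom0 _]/(one_dt t); set v := (one_dt t)^-1%VF x.
(* Putting x = (1 + d t) v removes every inverse: both sides of the Peiffer identity become s v + t
   d s v. *)
have -> : x = v + d g (t v) by rewrite -one_dtE K.
abel.
Qed.
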